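(* Let $2\leqslant n\in\mathbb{N}^+$, $2\leqslant b\in\mathbb{N}^+$ and $\tau\geqslant n-1$ (real). Then $$\widetilde{\mathcal{L}^2_{\tau+1,b}}(\mathbb{T}^n)\subset C^{[\tau+1-n/2]}(\mathbb{T}^n).$$
   Context: $[x]$ denotes the integral part of a real number $x$. $\mathbb{T}^n:=\mathbb{R}^n/2\pi\mathbb{Z}^n$. $C^\ell(\mathbb{T}^n)$, $\ell\geqslant0$, denotes the standard H\''older space; for integer $\ell$ this is the space of mappings with continuous classical derivatives up to order $\ell$ (functions being identified when equal almost everywhere). Functions are real mappings $f:\mathbb{T}^n\to\mathbb{R}^n$ with Fourier expansion $f(x)=\sum_{k\in\mathbb{Z}^n} f_k e^{\mathrm{i}\langle k,x\rangle}$, where $\langle k,x\rangle=\sum_{j=1}^n k_jx_j$ and $f_k=\int_{\mathbb{T}^n} f(x)e^{-\mathrm{i}\langle k,x\rangle}\,dx$ (the measure being normalized so that the expansion holds). For $k\in\mathbb{Z}^n$, $|k|:=\sum_{j=1}^n|k_j|$. Define $$\widetilde{\mathcal{L}^2_{\tau+1,b}}(\mathbb{T}^n):=\Big\{f:\ \sum_{\nu=0}^\infty\Big(\sum_{b^{\nu-1}<|k|\leqslant b^\nu}|f_k|^2|k|^{2\tau+2}\Big)^{1/2}<+\infty\Big\}.$$ *)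

(* Defs.v *)
From HB Require Import structures.
From mathcomp Require Import all_boot all_order all_algebra.
From mathcomp Require Import archimedean zify complex.
From mathcomp Require Import all_classical all_reals all_analysis.

Set Implicit Arguments.
Unset Strict Implicit.
Unset Printing Implicit Defensive.

Import Order.TTheory GRing.Theory Num.Theory.
Import numFieldNormedType.Exports.

Local Open Scope classical_set_scope.
Local Open Scope ring_scope.
Local Open Scope complex_scope.

(* A function on T^n = R^n / 2 pi Z^n is a 2 pi Z^n-periodic function on R^n,
   represented on row vectors; the measure lives on n.-tuple R, which carries
   the product sigma-algebra, and [row_of_tuple] links the two. *)

Section torus_measure.
Context {R : realType}.

Lemma two_pi_gt0 : (0 : R) < 2 * pi.
Proof. by rewrite mulr_gt0 ?pi_gt0. Qed.

Definition circle_prob : probability _ R := uniform_prob two_pi_gt0.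

Local Notation RM := (measurableTypeR R).

Definition tuple_cons n (z : RM * n.-tuple RM) : n.+1.-tuple RM :=
  [tuple of z.1 :: z.2].

Lemma measurable_tuple_cons n : measurable_fun setT (@tuple_cons n).
Proof. exact: measurable_cons. Qed.

HB.instance Definition _ n :=
  isMeasurableFun.Build _ _ _ _ (@tuple_cons n) (@measurable_tuple_cons n).

(* Normalized Lebesgue measure dx / (2 pi)^n on the period cell [0, 2 pi]^n. *)
Fixpoint torus_prob n : probability (n.-tuple RM) R :=
  match n with
  | 0 => dirac [tuple]
  | m.+1 => distribution (circle_prob \x torus_prob m)%E (@tuple_cons m)
  end.

End torus_measure.

Section torus_functions.
Context {R : realType}.
Variable n : nat.
Implicit Types (f g : 'rV[R]_n -> 'rV[R]_n) (k : 'rV[int]_n).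

Definition row_of_tuple (t : n.-tuple (measurableTypeR R)) : 'rV[R]_n :=
  \row_i tnth t i.

Definition torus_periodic f :=
  forall k x, f (x + (2 * pi) *: map_mx intr k) = f x.

Definition torus_integrable f := forall j,
  (torus_prob n).-integrable setT (fun t => (f (row_of_tuple t) 0 j)%:E).

Definition torus_ae_eq f g :=
  {ae torus_prob n, forall t, f (row_of_tuple t) = g (row_of_tuple t)}.

Definition freq_dot k (x : 'rV[R]_n) : R := \sum_j (k 0 j)%:~R * x 0 j.

Definition freq_norm k : nat := (\sum_j absz (k ord0 j))%N.

(* e^(i t) *)
Definition expi (t : R) : R[i] := cos t +i* sin t.

Definition torus_Cintegral (h : 'rV[R]_n -> R[i]) : R[i] :=
  (\int[torus_prob n]_(t in setT) complex.Re (h (row_of_tuple t))) +i*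
  (\int[torus_prob n]_(t in setT) complex.Im (h (row_of_tuple t))).

Definition fourier_coef f k : 'rV[R[i]]_n :=
  \row_j torus_Cintegral (fun x => (f x 0 j)%:C * expi (- freq_dot k x)).

(* Euclidean (Hermitian) norm on C^n, as opposed to the library's sup norm on
   matrices. *)
Definition Cvec_norm (v : 'rV[R[i]]_n) : R :=
  Num.sqrt (\sum_j Normc.normc (v 0 j) ^+ 2).

(* For nu = 0 the lower bound is b^-1, so the block is |k| = 1 and the zero
   frequency belongs to no block. *)
Definition freq_block (b nu : nat) : set 'rV[int]_n :=
  [set k | (b%:R : R) ^ (nu%:Z - 1) < ((freq_norm k)%:R : R) <= b%:R ^+ nu].

(* Hence the [\sum_(k \in _)] below, which is 0 by convention on infinite
   supports, is a genuine finite sum. *)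
Lemma finite_freq_block b nu : finite_set (freq_block b nu).
Proof.
pose N := (b ^ nu)%N.
pose F (g : {ffun 'I_n -> 'I_(N + N).+1}) : 'rV[int]_n :=
  \row_j ((g j)%:Z - N%:Z).
apply: (@sub_finite_set _ _ (F @` setT)); last first.
  exact/finite_image/finite_finset.
move=> k /= /andP[_]; rewrite -natrX ler_nat => kN.
have kjN j : (absz (k ord0 j) <= N)%N.
  by apply: leq_trans kN; rewrite /freq_norm (bigD1 j)//= leq_addr.
exists [ffun j => inord (absz (k ord0 j + N%:Z))] => //.
apply/rowP => j; rewrite mxE ffunE.
have := kjN j; set z := k ord0 j => zN.
rewrite inordK; lia.
Qed.

Definition block_norm (tau : R) (b nu : nat) f : R :=
  Num.sqrt (\sum_(k \in freq_block b nu)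
    Cvec_norm (fourier_coef f k) ^+ 2 * (freq_norm k)%:R `^ (2 * tau + 2)).

(* Integrability is the weakest assumption giving meaning to every Fourier
   coefficient; square integrability then follows from the summability. *)
Definition Ltilde2 (tau : R) (b : nat) : set ('rV[R]_n -> 'rV[R]_n) :=
  [set f | [/\ torus_periodic f, torus_integrable f &
    (\sum_(0 <= nu <oo) (block_norm tau b nu f)%:E < +oo)%E]].

Fixpoint continuously_differentiable (l : nat) f : Prop :=
  continuous f /\
  match l with
  | 0 => True
  | m.+1 => forall i : 'I_n,
      (forall x, derivable f x (delta_mx 0 i)) /\
      continuously_differentiable m ('D_(delta_mx 0 i) f)
  end.

(* C^l(T^n) for integer l, up to equality almost everywhere. *)
Definition Cl_torus (l : nat) : set ('rV[R]_n -> 'rV[R]_n) :=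
  [set f | torus_periodic f /\
    exists g, [/\ torus_periodic g, continuously_differentiable l g &
                  torus_ae_eq f g]].

End torus_functions.

(* Main.v *)
Require Import Defs.
From mathcomp Require Import all_boot all_order all_algebra.
From mathcomp Require Import archimedean zify ring lra complex.
From mathcomp Require Import all_classical all_reals all_analysis.
From mathcomp Require Import measurable_realfun.

Import Order.TTheory GRing.Theory Num.Theory.
Import numFieldNormedType.Exports.

Set Implicit Arguments.
Unset Strict Implicit.

Local Open Scope classical_set_scope.
Local Open Scope ring_scope.

(** Write a_k and b_k for the means of f_j(x) cos<k,x> and f_j(x) sin<k,x>, so
    that the j-th component of the Fourier coefficient is a_k - i b_k, and let
    g_j be the sum of the harmonics a_k cos<k,x> + b_k sin<k,x>, grouped into
    the frequency shells of the hypothesis.  The theorem says that g is of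
    class C^l for l = [tau + 1 - n/2], and that f = g almost everywhere.

    Smoothness.  A shell |k| ~ b^nu contains O(b^(nu n)) frequencies, so by the
    Cauchy-Schwarz inequality the sum of |f_k| |k|^l over it is at most
      (sum |f_k|^2 |k|^(2 tau + 2))^(1/2) * O(b^(nu (l - tau - 1 + n/2))),
    and the last factor is bounded exactly because l <= tau + 1 - n/2
    ([shell_weight_le_block]).  Summing over the shells, the hypothesis makes
    the series of |f_k| |k|^l converge ([coef_summable]).  Tannery's theorem
    ([tannery], dominated convergence for series) then yields the continuity
    of the series and, applied to difference quotients, its termwise
    differentiability; each derivative spends one power of |k|, and induction
    gives class C^l ([trig_series_Cl]).

    Identification.  The harmonics are orthogonal, and the series converges
    uniformly, so f and g have the same Fourier coefficients
    ([trig_series_cos_coef], [trig_series_sin_coef]).  Since f is only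
    assumed integrable, uniqueness of Fourier coefficients is required in L^1
    ([null_spectrum_ae0]): if h is integrable and all its coefficients vanish,
    then the integral of h p vanishes for every trigonometric polynomial p.
    The polynomials (1 - s^(2N))^(N 4^N) tend boundedly, for every s in [0,1],
    to the indicator of s < 1/2 ([step_poly_cvg]).  Composing them with
    trigonometric polynomials of one variable and multiplying over the
    coordinates produces the indicators of boxes, almost everywhere on the
    period cell.  Hence h has integral 0 over every box, by the pi-lambda
    theorem over every measurable set, and so h = 0 almost everywhere. *)

(** * Dominated convergence of series *)

Section tannery.
Context {R : realType}.
Implicit Types (M w : R^nat).

Lemma dominated_series_cvg M w : (forall m, `|w m| <= M m) ->
  cvgn (series M) -> cvgn (series w).
Proof.
move=> wM cM; have M0 m : 0 <= M m by exact: le_trans (normr_ge0 _) (wM m).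
by apply: normed_cvg; exact: (series_le_cvg _ M0 wM cM).
Qed.

(** The tail of the dominated series is bounded uniformly in the series; this
    uniformity is what [tannery] rests on. *)
Lemma dominated_series_tail M w N : (forall m, `|w m| <= M m) ->
  cvgn (series M) -> `|limn (series w) - series w N| <= limn (series M) - series M N.
Proof.
move=> wM cM; have cw := dominated_series_cvg wM cM.
have cN : (fun m => `|series w m - series w N|) @ \oo -->
    `|limn (series w) - series w N|.
  by apply: cvg_norm; apply: cvgB => //; exact: cvg_cst.
rewrite -(cvg_lim _ cN)//; apply: limr_le; first by apply/cvg_ex; eexists; exact: cN.
near=> m.
have Nm : (N <= m)%N by near: m; exists N.
rewrite (sub_series_geq _ Nm) (le_trans (ler_norm_sum _ _ _))//.
rewrite (le_trans (ler_sum _ (fun i _ => wM i)))//.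
rewrite -(sub_series_geq _ Nm) lerB//.
apply: nondecreasing_cvgn_le => // p q pq.
by rewrite -subr_ge0 sub_series_geq// sumr_ge0// => i _; exact: le_trans (normr_ge0 _) (wM i).
Unshelve. all: by end_near. Qed.

Lemma cvg_sumr (I T : Type) (F : set_system T) (FF : Filter F) (s : seq I)
    (f : I -> T -> R) (l : I -> R) : (forall i, f i t @[t --> F] --> l i) ->
  \sum_(i <- s) f i t @[t --> F] --> \sum_(i <- s) l i.
Proof.
by move=> fl; apply: cvg_big => [|i _]; [exact: add_continuous|exact: fl].
Qed.

(** A head of the series is a finite sum, which passes to the limit; the tails
    on both sides are bounded, uniformly in [t], by a tail of the series of [M].
    The filter is arbitrary, so that the statement serves for continuity (at a
    point) and for difference quotients (at a punctured neighbourhood of 0). *)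
Lemma tannery (T : Type) (F : set_system T) (u : nat -> T -> R) (v M : R^nat) :
  ProperFilter F -> cvgn (series M) -> (forall m t, `|u m t| <= M m) ->
  (forall m, u m t @[t --> F] --> v m) ->
  limn (series (u ^~ t)) @[t --> F] --> limn (series v).
Proof.
move=> PF cM uM uv.
have vM m : `|v m| <= M m.
  have vm : `|u m t| @[t --> F] --> `|v m| by apply: cvg_norm; exact: uv.
  rewrite -(cvg_lim _ vm)//; apply: limr_le; first by apply/cvg_ex; eexists; exact: vm.
  by near=> t; exact: uM.
apply/cvgrPdist_le => e e0.
have e3 : 0 < e / 3 by rewrite divr_gt0.
have [N _ /(_ _ (leqnn N))/= tailN] := (cvgrPdist_le _ _).1 cM _ e3.
have tail w : (forall m, `|w m| <= M m) -> `|limn (series w) - series w N| <= e / 3.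
  move=> wM; apply: le_trans (dominated_series_tail N wM cM) _.
  exact: le_trans (ler_norm _) tailN.
have uvN : series (u ^~ t) N @[t --> F] --> series v N.
  exact: cvg_sumr.
near=> t.
have h : `|series v N - series (u ^~ t) N| <= e / 3.
  by near: t; exact: (cvgrPdist_le _ _).1 uvN _ e3.
have hv := tail v vM; have hu := tail (u ^~ t) (uM ^~ t).
have := ler_distD (series v N) (limn (series v)) (limn (series (u ^~ t))).
have := ler_distD (series (u ^~ t) N) (series v N) (limn (series (u ^~ t))).
rewrite (distrC (series (u ^~ t) N)).
lra.
Unshelve. all: by end_near. Qed.
End tannery.

(** * Trigonometric series and their derivatives *)

Section trigonometric_series.
Context {R : realType} {n : nat}.
Implicit Types (k : 'rV[int]_n) (x : 'rV[R]_n) (a b : 'rV[int]_n -> R).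
Implicit Types (s : seq 'rV[int]_n) (sh : nat -> seq 'rV[int]_n).

Definition harmonic a b k x : R :=
  a k * cos (freq_dot k x) + b k * sin (freq_dot k x).

Definition trig_series sh a b x : R :=
  limn (series (fun nu => \sum_(k <- sh nu) harmonic a b k x)).

(** The power is taken of 1 + |k|, so that the weight grows with [l] also at the
    frequency 0, where |k|^l would drop from 1 to 0. *)
Definition shell_weight (l : nat) sh a b (nu : nat) : R :=
  \sum_(k <- sh nu) (`|a k| + `|b k|) * (freq_norm k).+1%:R ^+ l.

Lemma freq_dotD k x y : freq_dot k (x + y) = freq_dot k x + freq_dot k y :> R.
Proof.
by rewrite /freq_dot -big_split/=; apply: eq_bigr => j _; rewrite mxE mulrDr.
Qed.

Lemma freq_dotZ k (h : R) x : freq_dot k (h *: x) = h * freq_dot k x.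
Proof.
by rewrite /freq_dot mulr_sumr; apply: eq_bigr => j _; rewrite mxE mulrCA.
Qed.

Lemma freq_dot_delta k i : freq_dot k (delta_mx 0 i) = (k 0 i)%:~R :> R.
Proof.
rewrite /freq_dot (bigD1 i)//= mxE !eqxx mulr1 big1 ?addr0// => j ji.
by rewrite mxE (negbTE ji) andbF mulr0.
Qed.

Lemma freq_dot_continuous k : continuous (@freq_dot R n k).
Proof.
move=> x; apply: (@cvg_sumr _ _ _ (nbhs x)) => j.
apply: (@cvgM R _ (nbhs x) _ (cst (k 0 j)%:~R) (fun y => y 0 j)).
  exact: cvg_cst.
exact: coord_continuous.
Qed.

Lemma normr_freq_coord k i : `|(k 0 i)%:~R| <= (freq_norm k)%:R :> R.
Proof.
rewrite -intr_norm -[`|k 0 i|]abszE -pmulrn ler_nat.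
by rewrite /freq_norm (bigD1 i)//= leq_addr.
Qed.

Lemma normr_harmonic a b k x : `|harmonic a b k x| <= `|a k| + `|b k|.
Proof.
rewrite (le_trans (ler_normD _ _))// !normrM lerD//.
  by rewrite ler_piMr// cos_max.
by rewrite ler_piMr// sin_max.
Qed.

Lemma harmonic_continuous a b k : continuous (harmonic a b k).
Proof.
pose g t := a k * cos t + b k * sin t.
have cg : continuous g.
  move=> t; apply: cvgD; apply: cvgM; try exact: cvg_cst.
    exact: continuous_cos.
  exact: continuous_sin.
move=> x; apply: (@continuous_comp _ _ _ (freq_dot k) g); last exact: cg.
exact: freq_dot_continuous.
Qed.

Lemma normr_sum_harmonic s a b x :
  `|\sum_(k <- s) harmonic a b k x| <= \sum_(k <- s) (`|a k| + `|b k|).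
Proof.
by rewrite (le_trans (ler_norm_sum _ _ _))//; apply: ler_sum => k _;
  exact: normr_harmonic.
Qed.

Lemma shell_weight_ge0 l sh a b nu : 0 <= shell_weight l sh a b nu.
Proof. by apply: sumr_ge0 => k _; rewrite mulr_ge0// addr_ge0. Qed.

Lemma shell_weight_le l m sh a b nu : (l <= m)%N ->
  shell_weight l sh a b nu <= shell_weight m sh a b nu.
Proof.
move=> lm; apply: ler_sum => k _; rewrite ler_wpM2l ?addr_ge0//.
by rewrite ler_weXn2l// ler1n.
Qed.

Lemma shell_weight_cvg_le l m sh a b : (l <= m)%N ->
  cvgn (series (shell_weight m sh a b)) -> cvgn (series (shell_weight l sh a b)).
Proof.
move=> lm; apply: series_le_cvg => nu; try exact: shell_weight_ge0.
exact: shell_weight_le.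
Qed.

Lemma shell_dominated sh a b x nu :
  `|\sum_(k <- sh nu) harmonic a b k x| <= shell_weight 0 sh a b nu.
Proof.
rewrite (le_trans (normr_sum_harmonic _ _ _ _))//.
by apply: ler_sum => k _; rewrite expr0 mulr1.
Qed.

Lemma trig_series_continuous sh a b :
  cvgn (series (shell_weight 0 sh a b)) -> continuous (trig_series sh a b).
Proof.
move=> cw x; apply: (@tannery R _ (nbhs x) _ _ _ _ cw) => [nu y|nu].
  exact: shell_dominated.
apply: (@cvg_sumr _ _ _ (nbhs x)) => k.
exact: harmonic_continuous.
Qed.

(** Differentiating a cos<k,x> + b sin<k,x> in the direction e_i turns the
    pair of coefficients (a, b) into (k_i b, - k_i a). *)
Definition deriv_cos (i : 'I_n) b k : R := (k 0 i)%:~R * b k.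
Definition deriv_sin (i : 'I_n) a k : R := - ((k 0 i)%:~R * a k).

Lemma harmonic_line a b k x i (h : R) : harmonic a b k (h *: delta_mx 0 i + x) =
  a k * cos (h * (k 0 i)%:~R + freq_dot k x) +
  b k * sin (h * (k 0 i)%:~R + freq_dot k x).
Proof. by rewrite /harmonic freq_dotD freq_dotZ freq_dot_delta. Qed.

Lemma is_derive_harmonic_line a b k x i (h : R) :
  is_derive h 1 (fun h => harmonic a b k (h *: delta_mx 0 i + x))
  (harmonic (deriv_cos i b) (deriv_sin i a) k (h *: delta_mx 0 i + x)).
Proof.
rewrite harmonic_line (_ : (fun h => _) = (fun h : R =>
  a k * cos (h * (k 0 i)%:~R + freq_dot k x) +
  b k * sin (h * (k 0 i)%:~R + freq_dot k x))); last first.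
  by apply/funext => g; rewrite harmonic_line.
apply: is_derive_eq.
rewrite /deriv_cos /deriv_sin /GRing.scale/=; ring.
Qed.

(** Mean value theorem along the line. The bound on the difference quotient is
    uniform in the step [h], hence is a dominating sequence for [tannery]. *)
Lemma harmonic_diff_le a b k x i (h : R) :
  `|harmonic a b k (h *: delta_mx 0 i + x) - harmonic a b k x| <=
  `|h| * ((`|a k| + `|b k|) * (freq_norm k).+1%:R).
Proof.
pose g h := harmonic a b k (h *: delta_mx 0 i + x).
have -> : harmonic a b k x = g 0 by rewrite /g scale0r add0r.
rewrite -/(g h).
have bnd c : `|harmonic (deriv_cos i b) (deriv_sin i a) k (c *: delta_mx 0 i + x)|
    <= (`|a k| + `|b k|) * (freq_norm k).+1%:R.
  rewrite (le_trans (normr_harmonic _ _ _ _))// /deriv_cos /deriv_sin normrN !normrM.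
  rewrite -mulrDr addrC mulrC ler_wpM2l ?addr_ge0//.
  by rewrite (le_trans (normr_freq_coord _ _))// ler_nat.
have gc : continuous g.
  move=> y; apply/differentiable_continuous/derivable1_diffP.
  by have [] := is_derive_harmonic_line a b k x i y.
have [h0|h0] := leP 0 h.
  have [c _ ->] := MVT_segment h0
    (fun y _ => is_derive_harmonic_line a b k x i y) (continuous_subspaceT gc).
  by rewrite subr0 normrM mulrC ler_wpM2l.
have [c _] := MVT_segment (ltW h0)
    (fun y _ => is_derive_harmonic_line a b k x i y) (continuous_subspaceT gc).
rewrite -/(g 0) -/(g h) distrC => ->.
by rewrite sub0r normrM normrN mulrC ler_wpM2l.
Qed.

(** Termwise differentiation: the difference quotient of the series is the
    series of the difference quotients, dominated by the weights of order 1. *)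
Lemma trig_series_quotient sh a b i x :
  cvgn (series (shell_weight 1 sh a b)) ->
  h^-1 *: (trig_series sh a b (h *: delta_mx 0 i + x) - trig_series sh a b x)
    @[h --> (0 : R)^'] -->
  trig_series sh (deriv_cos i b) (deriv_sin i a) x.
Proof.
move=> cw1; have cw0 := shell_weight_cvg_le (leq0n 1) cw1.
have cx y := dominated_series_cvg (shell_dominated sh a b y) cw0.
pose u nu (h : R) := \sum_(k <- sh nu)
  h^-1 *: (harmonic a b k (h *: delta_mx 0 i + x) - harmonic a b k x).
have -> : (fun h => h^-1 *: (trig_series sh a b (h *: delta_mx 0 i + x) -
    trig_series sh a b x)) = (fun h => limn (series (u ^~ h))).
  apply/funext => h; rewrite /trig_series -lim_seriesB// -lim_seriesZ; last first.
    exact: is_cvg_seriesB.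
  by congr (limn (series _)); apply/funext => nu; rewrite /u -scaler_sumr sumrB.
apply: tannery cw1 _ _ => [nu h|nu].
  rewrite /u (le_trans (ler_norm_sum _ _ _))//; apply: ler_sum => k _.
  have [->|h0] := eqVneq h 0.
    by rewrite invr0 scale0r normr0 mulr_ge0// addr_ge0.
  rewrite normrZ normfV ler_pdivrMl ?normr_gt0//.
  exact: harmonic_diff_le.
apply: cvg_sumr => k.
have := is_derive_harmonic_line a b k x i 0.
rewrite scale0r add0r => -[dg eg]; move: dg; rewrite /derivable => /= /cvg_ex [l gl].
move: eg; rewrite /derive (cvg_lim _ gl)// => <-.
move: gl; rewrite scale0r add0r.
by under eq_fun do rewrite addr0 [_%:A]mulr1.
Qed.

Lemma row_continuous (f : 'I_n -> 'rV[R]_n -> R) :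
  (forall j, continuous (f j)) -> continuous (fun x => \row_j f j x).
Proof.
move=> fc x; have FF : Filter (nbhs x) := nbhs_filter x.
apply: (@cvgrPdist_le _ _ _ (nbhs x) FF (fun y => \row_j f j y) _).2 => e e0.
near=> y.
rewrite /Num.Def.normr/= mx_normrE (bigmax_le _ (ltW e0))//= => -[i j] _.
rewrite !mxE/=; move: j {i}; near: y; apply: filter_forall => j.
exact: (@cvgrPdist_le _ _ _ (nbhs x) FF _ _).1 (fc j x) _ e0.
Unshelve. all: by end_near. Qed.

(** By induction: a partial derivative is again a trigonometric series, with
    coefficients multiplied by k_i, so its weight of order [l] is at most the
    weight of order [l + 1] of the original. *)
Lemma trig_series_Cl l sh (a b : 'I_n -> 'rV[int]_n -> R) :
  (forall j, cvgn (series (shell_weight l sh (a j) (b j)))) ->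
  continuously_differentiable l (fun x => \row_j trig_series sh (a j) (b j) x).
Proof.
elim: l a b => [|l IHl] a b cw.
  by split => //; apply: row_continuous => j; exact: trig_series_continuous.
split.
  apply: row_continuous => j; apply: trig_series_continuous.
  exact: shell_weight_cvg_le (cw j).
move=> i.
have dq j x := @trig_series_quotient sh (a j) (b j) i x (shell_weight_cvg_le (ltn0Sn l) (cw j)).
have rowE_entry i0 j : (fun x => (\row_j0 trig_series sh (a j0) (b j0) x) i0 j) =
    trig_series sh (a j) (b j) by apply/funext => x; rewrite mxE.
have dg x : derivable (fun x => \row_j trig_series sh (a j) (b j) x) x
    (delta_mx 0 i).
  apply/derivable_mxP => i0 j; rewrite rowE_entry; apply/cvg_ex.
  by exists (trig_series sh (deriv_cos i (b j)) (deriv_sin i (a j)) x); exact: dq.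
split; first exact: dg.
have -> : 'D_(delta_mx 0 i) (fun x => \row_j trig_series sh (a j) (b j) x) =
    (fun x => \row_j trig_series sh (deriv_cos i (b j)) (deriv_sin i (a j)) x).
  apply/funext => x; rewrite derive_mx//; apply/matrixP => i0 j; rewrite !mxE.
  by rewrite rowE_entry; apply/cvg_lim => //; exact: dq.
apply: IHl => j; apply: series_le_cvg (cw j) => nu; try exact: shell_weight_ge0.
apply: ler_sum => k _; rewrite exprS mulrA ler_wpM2r// /deriv_cos /deriv_sin.
rewrite normrN !normrM -mulrDr addrC mulrC ler_wpM2l ?addr_ge0//.
by rewrite (le_trans (normr_freq_coord _ _))// ler_nat.
Qed.
End trigonometric_series.

(** * Means of characters over the torus *)

Section torus_means.
Context {R : realType}.
Local Notation RM := (measurableTypeR R).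

Lemma bounded_integrable d (T : measurableType d) (P : probability T R)
    (f : T -> R) (M : R) : measurable_fun setT f -> (forall x, `|f x| <= M) ->
  P.-integrable setT (EFin \o f).
Proof.
move=> mf fM; apply: measurable_bounded_integrable => //.
  by rewrite (le_lt_trans (probability_le1 _ _))// ltry.
exists M; split => [|y My x _]; first exact: num_real.
exact: le_trans (fM x) (ltW My).
Qed.

Lemma Rintegral_torusS n (f : n.+1.-tuple RM -> R) (M : R) :
  measurable_fun setT f -> (forall t, `|f t| <= M) ->
  \int[torus_prob n.+1]_t f t =
  \int[circle_prob]_x \int[torus_prob n]_t f (tuple_cons (x, t)).
Proof.
move=> mf fM.
have mg : measurable_fun setT (f \o @tuple_cons R n).
  by apply: measurableT_comp => //; exact: measurable_tuple_cons.
have ig : (circle_prob \x torus_prob n)%E.-integrable setT (EFin \o (f \o @tuple_cons R n)).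
  by apply: bounded_integrable mg _ => t; exact: fM.
rewrite /Rintegral /=; congr fine; rewrite integral_distribution//; last first.
  exact/measurable_EFinP.
rewrite -integral12_prod_meas1//; apply: eq_integral => x _.
rewrite /fubini_F fineK//; apply: integrable_fin_num => //.
apply: (@bounded_integrable _ _ _ (fun t => f (tuple_cons (x, t))) M) => [|t].
  apply: (measurableT_comp mg); exact: measurable_pair1.
exact: fM.
Qed.

(** For nonnegative [f] the passage to Lebesgue measure is unconditional;
    [circle_cos] and [circle_sin] apply it to 1 + cos and 1 + sin. *)
Lemma Rintegral_circle_ge0 (f F : R -> R) : continuous f -> (forall x, 0 <= f x) ->
  (forall x, is_derive x (1 : R) F (f x)) ->
  \int[circle_prob]_x f x = (2 * pi)^-1 * (F (2 * pi) - F 0).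
Proof.
move=> cf f0 dF; rewrite /Rintegral integral_uniform//; last first.
  by apply/measurable_EFinP; exact: continuous_measurable_fun.
have cF : continuous F.
  move=> y; apply/differentiable_continuous/derivable1_diffP.
  by have [] := dF y.
rewrite (@continuous_FTC2 _ f F)//.
- by rewrite subr0 -EFinB -EFinM.
- exact: two_pi_gt0.
- exact: continuous_subspaceT.
- split => [x _||]; first by have [] := dF x.
  + exact/cvg_at_right_filter/cF.
  + exact/cvg_at_left_filter/cF.
- by move=> x _; rewrite derive1E; have [] := dF x.
Qed.

Lemma cos_int2pi (m : int) : cos (m%:~R * (2 * pi)) = 1 :> R.
Proof.
have h (p : nat) : cos (p%:R * (2 * pi)) = 1 :> R.
  rewrite (mulr_natl _ p); have := periodicn (@cosD2pi R) p 0.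
  by rewrite add0r cos0 -(mulr_natl pi).
by case: m => p; [exact: h|rewrite NegzE mulrNz mulNr cosN; exact: h].
Qed.

Lemma sin_int2pi (m : int) : sin (m%:~R * (2 * pi)) = 0 :> R.
Proof. by apply: cos1sin0; rewrite cos_int2pi normr1. Qed.

Lemma trig_measurable d (T : measurableType d) (f : R -> R) (g : T -> R) :
  continuous f -> measurable_fun setT g -> measurable_fun setT (f \o g).
Proof.
by move=> cf mg; apply: measurableT_comp => //; exact: continuous_measurable_fun.
Qed.

Lemma lin_continuous (c : R) : continuous (fun x : R => c * x).
Proof. by move=> x; apply: cvgM; [exact: cvg_cst|exact: cvg_id]. Qed.

Lemma circle_cos (m : int) :
  \int[circle_prob]_x cos (m%:~R * x) = (m == 0)%:R :> R.
Proof.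
have [->|m0] := eqVneq m 0.
  under eq_Rintegral do rewrite mul0r cos0.
  by rewrite Rintegral_cst// [X in fine X]probability_setT mul1r.
have m0' : m%:~R != 0 :> R by rewrite intr_eq0.
have cc : continuous (fun x : R => cos (m%:~R * x)).
  by move=> x; apply: continuous_comp; [exact: lin_continuous|exact: continuous_cos].
have : \int[circle_prob]_x (1 + cos (m%:~R * x)) = 1 :> R.
  have hc : continuous (fun x : R => 1 + cos (m%:~R * x)).
    by move=> x; apply: cvgD; [exact: cvg_cst|exact: cc].
  have h0 (x : R) : 0 <= 1 + cos (m%:~R * x) by rewrite -lerBlDl sub0r cos_geN1.
  have hd (x : R) : is_derive x (1 : R) (fun x => x + m%:~R^-1 * sin (m%:~R * x))
      (1 + cos (m%:~R * x)).
    by apply: is_derive_eq; rewrite /GRing.scale/=; field.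
  rewrite (Rintegral_circle_ge0 hc h0 hd).
  rewrite sin_int2pi !mulr0 sin0 !mulr0 !addr0 subr0 mulVf// gt_eqF//.
  exact: two_pi_gt0.
rewrite RintegralD//.
- rewrite Rintegral_cst// [X in fine X]probability_setT mul1r.
  by move/(canRL (addKr _)); rewrite addNr.
- exact: finite_measure_integrable_cst.
- apply: (@bounded_integrable _ _ _ _ 1) => [|x]; last exact: cos_max.
  exact: continuous_measurable_fun.
Qed.

Lemma circle_sin (m : int) : \int[circle_prob]_x sin (m%:~R * x) = 0 :> R.
Proof.
have [->|m0] := eqVneq m 0.
  under eq_Rintegral do rewrite mul0r sin0.
  by rewrite Rintegral_cst// mul0r.
have m0' : m%:~R != 0 :> R by rewrite intr_eq0.
have cc : continuous (fun x : R => sin (m%:~R * x)).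
  by move=> x; apply: continuous_comp; [exact: lin_continuous|exact: continuous_sin].
have : \int[circle_prob]_x (1 + sin (m%:~R * x)) = 1 :> R.
  have hc : continuous (fun x : R => 1 + sin (m%:~R * x)).
    by move=> x; apply: cvgD; [exact: cvg_cst|exact: cc].
  have h0 (x : R) : 0 <= 1 + sin (m%:~R * x) by rewrite -lerBlDl sub0r sin_geN1.
  have hd (x : R) : is_derive x (1 : R) (fun x => x - m%:~R^-1 * cos (m%:~R * x))
      (1 + sin (m%:~R * x)).
    by apply: is_derive_eq; rewrite /GRing.scale/=; field.
  rewrite (Rintegral_circle_ge0 hc h0 hd).
  rewrite cos_int2pi !mulr0 cos0 sub0r opprK mulr1 subrK mulVf// gt_eqF//.
  exact: two_pi_gt0.
rewrite RintegralD//.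
- rewrite Rintegral_cst// [X in fine X]probability_setT mul1r.
  by move/(canRL (addKr _)); rewrite addNr.
- exact: finite_measure_integrable_cst.
- apply: (@bounded_integrable _ _ _ _ 1) => [|x]; last exact: sin_max.
  exact: continuous_measurable_fun.
Qed.

Lemma measurable_freq_dot n (k : 'rV[int]_n) :
  measurable_fun setT (fun t : n.-tuple RM => freq_dot k (row_of_tuple t)).
Proof.
rewrite /freq_dot; apply: measurable_sum => j.
under eq_fun do rewrite mxE.
by apply: measurable_funM => //; exact: measurable_tnth.
Qed.

(** Fubini on the last-added coordinate: by the addition formulas the mean in
    dimension n + 1 factors into means over the circle and in dimension n. *)
Lemma torus_char n (k : 'rV[int]_n) :
  \int[torus_prob n]_t cos (freq_dot k (row_of_tuple t)) = (k == 0)%:R :> R /\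
  \int[torus_prob n]_t sin (freq_dot k (row_of_tuple t)) = 0 :> R.
Proof.
elim: n k => [|n IHn] k.
  have d0 t : freq_dot k (row_of_tuple (t : 0.-tuple RM)) = 0 by rewrite /freq_dot big_ord0.
  split.
    under eq_Rintegral do rewrite d0 cos0.
    by rewrite Rintegral_cst// [X in fine X]probability_setT mul1r [k]thinmx0 eqxx.
  under eq_Rintegral do rewrite d0 sin0.
  by rewrite Rintegral_cst// mul0r.
pose k' : 'rV[int]_n := \row_i k 0 (lift ord0 i).
have kk : (k == 0) = (k 0 ord0 == 0) && (k' == 0).
  apply/eqP/andP => [k0|[/eqP k00 /eqP/rowP k'0]].
    by split; [rewrite k0 mxE|apply/eqP/rowP => i; rewrite /k' k0 !mxE].
  apply/rowP => i; rewrite mxE; case: (unliftP ord0 i) => [j|] -> //.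
  by have := k'0 j; rewrite /k' !mxE.
have dS x t : freq_dot k (row_of_tuple (@tuple_cons R n (x, t))) =
    (k 0 ord0)%:~R * x + freq_dot k' (row_of_tuple t).
  rewrite /freq_dot big_ord_recl !mxE tnth0; congr (_ + _).
  by apply: eq_bigr => i _; rewrite /k' !mxE tnthS.
have [IHc IHs] := IHn k'.
have mc : measurable_fun setT
    (fun t : n.-tuple RM => cos (freq_dot k' (row_of_tuple t) : R)).
  by apply: trig_measurable; [exact: continuous_cos|exact: measurable_freq_dot].
have ms : measurable_fun setT
    (fun t : n.-tuple RM => sin (freq_dot k' (row_of_tuple t) : R)).
  by apply: trig_measurable; [exact: continuous_sin|exact: measurable_freq_dot].
have ic (r : R) : (torus_prob n).-integrable setT
    (EFin \o (fun t => r * cos (freq_dot k' (row_of_tuple t)))).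
  apply: (@bounded_integrable _ _ _ _ `|r|) => [|t]; first exact: measurable_funM.
  by rewrite normrM ler_piMr// cos_max.
have iS (r : R) : (torus_prob n).-integrable setT
    (EFin \o (fun t => r * sin (freq_dot k' (row_of_tuple t)))).
  apply: (@bounded_integrable _ _ _ _ `|r|) => [|t]; first exact: measurable_funM.
  by rewrite normrM ler_piMr// sin_max.
have ic1 := bounded_integrable (torus_prob n) mc (fun t => cos_max _).
have is1 := bounded_integrable (torus_prob n) ms (fun t => sin_max _).
split.
- rewrite (@Rintegral_torusS _ _ 1); last 2 first.
  + by apply: trig_measurable; [exact: continuous_cos|exact: measurable_freq_dot].
  + by move=> t; exact: cos_max.
  under eq_Rintegral => x _.
    under eq_Rintegral do rewrite dS cosD.
    rewrite RintegralB// !RintegralZl// IHc IHs mulr0 subr0.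
    over.
  rewrite RintegralZr//; first by rewrite circle_cos kk -natrM mulnb.
  apply: (@bounded_integrable _ _ _ _ 1) => [|x]; last exact: cos_max.
  apply: trig_measurable; first exact: continuous_cos.
  by apply: measurable_funM => //; exact: measurable_id.
- rewrite (@Rintegral_torusS _ _ 1); last 2 first.
  + by apply: trig_measurable; [exact: continuous_sin|exact: measurable_freq_dot].
  + by move=> t; exact: sin_max.
  under eq_Rintegral => x _.
    under eq_Rintegral do rewrite dS sinD.
    rewrite RintegralD// !RintegralZl// IHc IHs mulr0 addr0.
    over.
  rewrite RintegralZr//; first by rewrite circle_sin mul0r.
  apply: (@bounded_integrable _ _ _ _ 1) => [|x]; last exact: sin_max.
  apply: trig_measurable; first exact: continuous_sin.
  by apply: measurable_funM => //; exact: measurable_id.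
Qed.
End torus_means.

(** * Fourier coefficients of a trigonometric series *)

Section series_coefficients.
Context {R : realType} {n : nat}.
Local Notation RM := (measurableTypeR R).
Implicit Types (k m : 'rV[int]_n) (a b : 'rV[int]_n -> R).

Lemma Rintegral_dominated_cvg d (T : measurableType d)
    (P : {measure set T -> \bar R}) (f_ : nat -> T -> R) (f g : T -> R) :
  (forall N, measurable_fun setT (f_ N)) ->
  (forall t, f_ N t @[N --> \oo] --> f t) ->
  P.-integrable setT (EFin \o g) -> (forall N t, `|f_ N t| <= g t) ->
  \int[P]_t f_ N t @[N --> \oo] --> \int[P]_t f t.
Proof.
move=> mf_ f_f ig f_g.
have mf : measurable_fun setT f.
  by apply: (@measurable_fun_cvg _ _ _ _ f_) => // t _; exact: f_f.
have [||||iF _ cF] := @dominated_convergence _ _ _ P setT measurableT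
    (fun N t => (f_ N t)%:E) (fun t => (f t)%:E) (fun t => (g t)%:E) _ _ _ ig _.
- by move=> N; exact/measurable_EFinP.
- exact/measurable_EFinP.
- by apply: aeW => t _; apply: cvg_EFin; [exact: nearW|exact: f_f].
- by apply: aeW => t N _; rewrite abse_EFin lee_fin.
apply: fine_cvg; rewrite fineK//; exact: integrable_fin_num.
Qed.

Lemma Rintegral_sum d (T : measurableType d) (P : {measure set T -> \bar R})
    (I : Type) (s : seq I) (f : I -> T -> R) :
  (forall i, P.-integrable setT (EFin \o f i)) ->
  \int[P]_t (\sum_(i <- s) f i t) = \sum_(i <- s) \int[P]_t f i t.
Proof.
move=> fi; have is_ r : P.-integrable setT (EFin \o (fun t => \sum_(i <- r) f i t)).
  rewrite (_ : _ \o _ = fun t => (\sum_(i <- r) (f i t)%:E)%E); last first.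
    by apply/funext => t; rewrite /= sumEFin.
  by apply: integrable_sum => // i _; exact: fi.
elim: s => [|i s IHs].
  by rewrite big_nil; under eq_Rintegral do rewrite big_nil; rewrite Rintegral_cst// mul0r.
rewrite big_cons -IHs -RintegralD//.
by under eq_Rintegral do rewrite big_cons.
Qed.

Lemma freq_dotDl k m (x : 'rV[R]_n) : freq_dot (k + m) x = freq_dot k x + freq_dot m x.
Proof.
rewrite /freq_dot -big_split/=; apply: eq_bigr => j _.
by rewrite mxE rmorphD mulrDl.
Qed.

Lemma freq_dotNl k (x : 'rV[R]_n) : freq_dot (- k) x = - freq_dot k x.
Proof.
rewrite /freq_dot -sumrN; apply: eq_bigr => j _.
by rewrite mxE rmorphN mulNr.
Qed.

Definition tcos k (t : n.-tuple RM) : R := cos (freq_dot k (row_of_tuple t)).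
Definition tsin k (t : n.-tuple RM) : R := sin (freq_dot k (row_of_tuple t)).

Lemma measurable_tcos k : measurable_fun setT (tcos k).
Proof. by apply: trig_measurable; [exact: continuous_cos|exact: measurable_freq_dot]. Qed.

Lemma measurable_tsin k : measurable_fun setT (tsin k).
Proof. by apply: trig_measurable; [exact: continuous_sin|exact: measurable_freq_dot]. Qed.

Lemma tcosM k m t : tcos k t * tcos m t = 2^-1 * (tcos (k - m) t + tcos (k + m) t).
Proof. by rewrite /tcos !freq_dotDl !freq_dotNl cosB cosD; field. Qed.

Lemma tsinM k m t : tsin k t * tsin m t = 2^-1 * (tcos (k - m) t - tcos (k + m) t).
Proof. by rewrite /tcos /tsin !freq_dotDl !freq_dotNl cosB cosD; field. Qed.

Lemma tsincosM k m t : tsin k t * tcos m t = 2^-1 * (tsin (k + m) t + tsin (k - m) t).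
Proof. by rewrite /tcos /tsin !freq_dotDl !freq_dotNl sinB sinD; field. Qed.

Lemma integrable_tcos k : (torus_prob n).-integrable setT (EFin \o tcos k).
Proof.
by apply: (@bounded_integrable _ _ _ _ _ 1) => [|t]; [exact: measurable_tcos|exact: cos_max].
Qed.

Lemma integrable_tsin k : (torus_prob n).-integrable setT (EFin \o tsin k).
Proof.
by apply: (@bounded_integrable _ _ _ _ _ 1) => [|t]; [exact: measurable_tsin|exact: sin_max].
Qed.

Lemma mean_tcos k : \int[torus_prob n]_t tcos k t = (k == 0)%:R.
Proof. exact: (torus_char k).1. Qed.

Lemma mean_tsin k : \int[torus_prob n]_t tsin k t = 0.
Proof. exact: (torus_char k).2. Qed.

Lemma integrable_lin (f g : n.-tuple RM -> R) (c d : R) :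
  (torus_prob n).-integrable setT (EFin \o f) ->
  (torus_prob n).-integrable setT (EFin \o g) ->
  (torus_prob n).-integrable setT (EFin \o (fun t => c * f t + d * g t)).
Proof.
move=> fi gi.
rewrite (_ : _ \o _ = (fun t => c%:E * (f t)%:E + d%:E * (g t)%:E)%E)//.
by apply: integrableD => //; exact: integrableZl.
Qed.

Lemma Rintegral_lin (f g : n.-tuple RM -> R) (c d : R) :
  (torus_prob n).-integrable setT (EFin \o f) ->
  (torus_prob n).-integrable setT (EFin \o g) ->
  \int[torus_prob n]_t (c * f t + d * g t) =
  c * \int[torus_prob n]_t f t + d * \int[torus_prob n]_t g t.
Proof.
move=> fi gi; rewrite RintegralD// ?RintegralZl//.
  rewrite (_ : _ \o _ = (fun t => c%:E * (f t)%:E)%E)//; exact: integrableZl.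
rewrite (_ : _ \o _ = (fun t => d%:E * (g t)%:E)%E)//; exact: integrableZl.
Qed.

(** In real form the harmonics of k and of -k are not independent, which is why
    both frequencies contribute, each with weight 1/2. *)
Lemma mean_harmonic_cos a b k m :
  \int[torus_prob n]_t (harmonic a b k (row_of_tuple t) * tcos m t) =
  a k * (2^-1 * ((k == m)%:R + (k == - m)%:R)).
Proof.
rewrite (_ : (fun t => _) = (fun t =>
    a k * (2^-1 * tcos (k - m) t + 2^-1 * tcos (k + m) t) +
    b k * (2^-1 * tsin (k + m) t + 2^-1 * tsin (k - m) t))); last first.
  by apply/funext => t; rewrite -!mulrDr -tcosM -tsincosM mulrDl -!mulrA.
rewrite Rintegral_lin; [|exact: (integrable_lin _ _ (integrable_tcos _) (integrable_tcos _))
  |exact: (integrable_lin _ _ (integrable_tsin _) (integrable_tsin _))].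
rewrite Rintegral_lin; [|exact: integrable_tcos..].
rewrite Rintegral_lin; [|exact: integrable_tsin..].
by rewrite !mean_tcos !mean_tsin subr_eq0 addr_eq0 mulr0 addr0 mulr0 addr0 -mulrDr.
Qed.

Lemma mean_harmonic_sin a b k m :
  \int[torus_prob n]_t (harmonic a b k (row_of_tuple t) * tsin m t) =
  b k * (2^-1 * ((k == m)%:R - (k == - m)%:R)).
Proof.
rewrite (_ : (fun t => _) = (fun t =>
    a k * (2^-1 * tsin (m + k) t + 2^-1 * tsin (m - k) t) +
    b k * (2^-1 * tcos (k - m) t + (- 2^-1) * tcos (k + m) t))); last first.
  apply/funext => t; rewrite mulNr -mulrBr -!mulrDr -tsinM -tsincosM.
  by rewrite mulrDl -!mulrA [tsin m t * _]mulrC.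
rewrite Rintegral_lin; [|exact: (integrable_lin _ _ (integrable_tsin _) (integrable_tsin _))
  |exact: (integrable_lin _ _ (integrable_tcos _) (integrable_tcos _))].
rewrite Rintegral_lin; [|exact: integrable_tsin..].
rewrite Rintegral_lin; [|exact: integrable_tcos..].
rewrite !mean_tcos !mean_tsin subr_eq0 addr_eq0 mulr0 addr0 mulr0 add0r.
by rewrite mulNr -mulrBr.
Qed.

Lemma sum_delta (s : seq 'rV[int]_n) (c : 'rV[int]_n -> R) m : uniq s ->
  \sum_(k <- s) c k * (k == m)%:R = c m * (m \in s)%:R.
Proof.
move=> us; case: (boolP (m \in s)) => ms.
  rewrite (bigD1_seq m)//= eqxx big1 ?addr0// => k /negbTE ->.
  by rewrite mulr0.
rewrite big_seq big1 ?mulr0// => k ks.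
by case: eqP ks => [->|_ _]; rewrite ?mulr0// (negbTE ms).
Qed.

Section coefficients.
Variables (sh : nat -> seq 'rV[int]_n) (a b : 'rV[int]_n -> R).
Hypothesis sh_uniq : forall nu, uniq (sh nu).
Hypothesis sh_opp : forall nu k, (- k \in sh nu) = (k \in sh nu).
Hypothesis sh_cover : forall k, exists nu0, forall nu, (k \in sh nu) = (nu == nu0).
Hypothesis a_even : forall k, a (- k) = a k.
Hypothesis b_odd : forall k, b (- k) = - b k.
Hypothesis ab_summable : cvgn (series (shell_weight 0 sh a b)).

Lemma measurable_harmonic k :
  measurable_fun setT (fun t : n.-tuple RM => harmonic a b k (row_of_tuple t)).
Proof.
apply: measurable_funD; apply: measurable_funM => //; first exact: measurable_tcos.
exact: measurable_tsin.
Qed.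

Lemma trig_series_cvg x :
  series (fun nu => \sum_(k <- sh nu) harmonic a b k x) N @[N --> \oo] -->
  trig_series sh a b x.
Proof. exact: dominated_series_cvg (shell_dominated sh a b x) ab_summable. Qed.

Lemma series_measurable N : measurable_fun setT (fun t : n.-tuple RM =>
  series (fun nu => \sum_(k <- sh nu) harmonic a b k (row_of_tuple t)) N).
Proof. by do 2 apply: measurable_sum => ?; exact: measurable_harmonic. Qed.

Lemma trig_series_measurable :
  measurable_fun setT (fun t : n.-tuple RM => trig_series sh a b (row_of_tuple t)).
Proof.
apply: (measurable_fun_cvg series_measurable) => t _; exact: trig_series_cvg.
Qed.

Lemma series_bounded N x :
  `|series (fun nu => \sum_(k <- sh nu) harmonic a b k x) N| <=
  limn (series (shell_weight 0 sh a b)).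
Proof.
rewrite (le_trans (ler_norm_sum _ _ _))//.
apply: (@le_trans _ _ (series (shell_weight 0 sh a b) N)).
  by apply: ler_sum => nu _; exact: shell_dominated.
apply: nondecreasing_cvgn_le => // p q pq.
by rewrite -subr_ge0 sub_series_geq// sumr_ge0// => i _; exact: shell_weight_ge0.
Qed.

Lemma trig_series_bounded x :
  `|trig_series sh a b x| <= limn (series (shell_weight 0 sh a b)).
Proof.
have := dominated_series_tail 0 (shell_dominated sh a b x) ab_summable.
by rewrite /series/= !big_geq// !subr0.
Qed.

(** The partial sums are uniformly bounded, so the mean of the series is the
    limit of their means; by hypothesis these are constant as soon as the shell
    of [m] has been reached. *)
Lemma coef_from_blocks (phi : n.-tuple RM -> R) m (c : R) :
  measurable_fun setT phi -> (forall t, `|phi t| <= 1) ->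
  (forall nu, \sum_(k <- sh nu)
    \int[torus_prob n]_t (harmonic a b k (row_of_tuple t) * phi t) =
    c * (m \in sh nu)%:R) ->
  \int[torus_prob n]_t (trig_series sh a b (row_of_tuple t) * phi t) = c.
Proof.
move=> mphi phi1 blk.
pose S N x := series (fun nu => \sum_(k <- sh nu) harmonic a b k x) N.
have ih k : (torus_prob n).-integrable setT
    (EFin \o (fun t => harmonic a b k (row_of_tuple t) * phi t)).
  apply: (@bounded_integrable _ _ _ _ _ (`|a k| + `|b k|)) => [|t].
    by apply: measurable_funM => //; exact: measurable_harmonic.
  rewrite normrM (le_trans (ler_pM _ _ (normr_harmonic _ _ _ _) (phi1 t)))//.
  by rewrite mulr1.
have SE N : \int[torus_prob n]_t (S N (row_of_tuple t) * phi t) =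
    \sum_(0 <= nu < N) c * (m \in sh nu)%:R.
  rewrite /S /series/=.
  under eq_Rintegral do rewrite mulr_suml.
  rewrite Rintegral_sum.
    apply: eq_bigr => nu _; rewrite -blk.
    by under eq_Rintegral do rewrite mulr_suml; rewrite Rintegral_sum.
  move=> nu; rewrite (_ : _ \o _ = fun t => (\sum_(k <- sh nu)
      (harmonic a b k (row_of_tuple t) * phi t)%:E)%E); last first.
    by apply/funext => t; rewrite /= mulr_suml sumEFin.
  by apply: integrable_sum => // k _; exact: ih.
have cS : \int[torus_prob n]_t (S N (row_of_tuple t) * phi t) @[N --> \oo] -->
    \int[torus_prob n]_t (trig_series sh a b (row_of_tuple t) * phi t).
  apply: (@Rintegral_dominated_cvg _ _ _ _ _
      (fun=> limn (series (shell_weight 0 sh a b)))).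
  - by move=> N; apply: measurable_funM => //; exact: series_measurable.
  - by move=> t; apply: cvgM; [exact: trig_series_cvg|exact: cvg_cst].
  - exact: finite_measure_integrable_cst.
  - move=> N t; rewrite normrM.
    by rewrite (le_trans (ler_pM _ _ (series_bounded _ _) (phi1 t)))// mulr1.
rewrite -(cvg_lim _ cS)//; apply: cvg_lim => //.
have [nu0 mnu0] := sh_cover m.
apply: cvg_near_cst.
exists nu0.+1 => // N /= nu0N; rewrite SE -mulr_sumr.
rewrite (bigD1_seq nu0)/= ?mem_index_iota ?iota_uniq// mnu0 eqxx.
rewrite big1 ?addr0 ?mulr1// => nu nunu0.
by rewrite mnu0 (negbTE nunu0).
Qed.

Lemma trig_series_cos_coef m :
  \int[torus_prob n]_t (trig_series sh a b (row_of_tuple t) * tcos m t) = a m.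
Proof.
apply: (@coef_from_blocks _ m) => [|t|nu].
- exact: measurable_tcos.
- exact: cos_max.
under eq_bigr do rewrite mean_harmonic_cos mulrCA mulrDr.
rewrite -mulr_sumr big_split/= !sum_delta// sh_opp a_even -mulr2n -(mulr_natl (_ * _)).
by rewrite mulKf// pnatr_eq0.
Qed.

Lemma trig_series_sin_coef m :
  \int[torus_prob n]_t (trig_series sh a b (row_of_tuple t) * tsin m t) = b m.
Proof.
apply: (@coef_from_blocks _ m) => [|t|nu].
- exact: measurable_tsin.
- exact: sin_max.
under eq_bigr do rewrite mean_harmonic_sin mulrCA mulrBr.
rewrite -mulr_sumr sumrB !sum_delta// sh_opp b_odd mulNr opprK -mulr2n -(mulr_natl (_ * _)).
by rewrite mulKf// pnatr_eq0.
Qed.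
End coefficients.
End series_coefficients.

(** * Polynomial approximation of a step *)

Section step_approximation.
Context {R : realType}.

Lemma bernoulli_le (y : R) M : 0 <= y <= 1 -> 1 - M%:R * y <= (1 - y) ^+ M.
Proof.
move=> /andP[y0 y1]; elim: M => [|M IHM]; first by rewrite mul0r subr0 expr0.
rewrite exprS (le_trans _ (ler_wpM2l _ IHM)) ?subr_ge0//.
have : 0 <= M%:R * y ^+ 2 by rewrite mulr_ge0// sqr_ge0.
rewrite -natr1 expr2; lra.
Qed.

Lemma bernoulli_ge (y : R) M : 0 <= y -> 1 + M%:R * y <= (1 + y) ^+ M.
Proof.
move=> y0; elim: M => [|M IHM]; first by rewrite mul0r addr0 expr0.
rewrite exprS (le_trans _ (ler_wpM2l _ IHM)) ?addr_ge0//.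
have : 0 <= M%:R * y ^+ 2 by rewrite mulr_ge0// sqr_ge0.
rewrite -natr1 expr2; lra.
Qed.

(** Each of the first N terms of the geometric series is at least r^N, so N r^N
    is at most their sum. *)
Lemma natmul_expr_le (r : R) N : 0 <= r < 1 -> N%:R * r ^+ N <= (1 - r)^-1.
Proof.
move=> /andP[r0 r1]; have r1' : 0 < 1 - r by rewrite subr_gt0.
rewrite -[leRHS]mul1r ler_pdivlMr// mulrC.
apply: (@le_trans _ _ ((1 - r) * \sum_(i < N) r ^+ i)).
  rewrite ler_wpM2l ?(ltW r1')//.
  rewrite (_ : N%:R * r ^+ N = \sum_(i < N) r ^+ N); last first.
    by rewrite sumr_const card_ord mulr_natl.
  apply: ler_sum => i _; rewrite ler_wiXn2l ?(ltW r1)//.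
  exact: ltnW.
have := exprn_ge0 N r0; have := subrX1 r N; set S := \sum_(i < N) _.
nra.
Qed.

(** The exponent N 4^N lies between the two scales that matter: it is large
    against (1/2)^(-2N), so that the value at s = 1/2 and beyond tends to 0, and
    its product with s^(2N) still tends to 0 for s < 1/2. *)
Definition step_poly (N : nat) (s : R) : R := (1 - s ^+ (2 * N)) ^+ (N * 4 ^ N).

Lemma step_poly_bounds N (s : R) : 0 <= s <= 1 -> 0 <= step_poly N s <= 1.
Proof.
move=> /andP[s0 s1]; have h : 0 <= 1 - s ^+ (2 * N) <= 1.
  by rewrite subr_ge0 exprn_ile1//= lerBlDr lerDl exprn_ge0.
by move/andP: h => [h0 h1]; rewrite exprn_ge0//= exprn_ile1.
Qed.

(** Below 1/2, Bernoulli's inequality gives 1 - N (2s)^(2N) as a lower bound.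
    From 1/2 on, with y = 4^(-N) <= s^(2N), the value is at most
    (1 - y)^M <= (1 + y)^(-M) <= 1 / (1 + M y) where M y = N.  Convergence at
    the threshold itself makes the limit the exact indicator of a half-open
    interval, so that no level set has to be shown negligible. *)
Lemma step_poly_cvg (s : R) : 0 <= s <= 1 ->
  step_poly N s @[N --> \oo] --> ((s < 2^-1)%R%:R : R).
Proof.
move=> s01; have /andP[s0 s1] := s01; case: ltP => hs.
- pose r := 2 * s.
  have r01 : 0 <= r < 1 by rewrite /r; lra.
  have cr : 1 - (1 - r)^-1 * r ^+ N @[N --> \oo] --> (1 : R).
    rewrite -[X in _ --> X]subr0; apply: cvgB; first exact: cvg_cst.
    apply: cvg_geometric; rewrite ger0_norm; lra.
  apply: (squeeze_cvgr _ cr (cvg_cst _)); apply: nearW => N.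
  have /andP[_ ->] := step_poly_bounds N s01; rewrite andbT.
  rewrite (le_trans _ (bernoulli_le _ _))//; last first.
    by rewrite exprn_ge0// exprn_ile1.
  rewrite lerD2l lerN2.
  have -> : (N * 4 ^ N)%:R * s ^+ (2 * N) = (N%:R * r ^+ N) * r ^+ N :> R.
    rewrite natrM natrX -!mulrA; congr (_ * _).
    by rewrite -exprMn exprM -exprMn; congr (_ ^+ _); rewrite /r; ring.
  by rewrite ler_wpM2r ?natmul_expr_le// exprn_ge0//; case/andP: r01.
- have cN : (N%:R + 1)^-1 @[N --> \oo] --> (0 : R).
    by under eq_fun do rewrite natr1; exact: cvg_harmonic.
  apply: (squeeze_cvgr _ (cvg_cst _) cN); apply: nearW => N.
  have /andP[-> _]/= := step_poly_bounds N s01.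
  pose y : R := 4^-1 ^+ N.
  have y0 : 0 <= y by rewrite exprn_ge0.
  have ys : y <= s ^+ (2 * N).
    rewrite /y exprM lerXn2r ?nnegrE ?sqr_ge0// expr2; nra.
  have s1' : s ^+ (2 * N) <= 1 by rewrite exprn_ile1.
  apply: (@le_trans _ _ ((1 - y) ^+ (N * 4 ^ N))).
    by rewrite lerXn2r ?nnegrE; lra.
  (* (1 - y) (1 + y) <= 1, and (1 + y)^M >= 1 + N *)
  have hM : (N * 4 ^ N)%:R * y = N%:R :> R.
    by rewrite natrM natrX -mulrA -exprMn mulfV// expr1n mulr1.
  have := bernoulli_ge (N * 4 ^ N) y0; rewrite hM => hb.
  have N1 : 0 < N%:R + 1 :> R by rewrite ltr_wpDl.
  rewrite -[leRHS]mul1r ler_pdivlMr//.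
  rewrite addrC in hb.
  rewrite (le_trans (ler_wpM2l _ hb)) ?exprn_ge0//; first lra.
  rewrite -exprMn exprn_ile1//; nra.
Qed.

(** The arc ]0, c[ is centred at c/2, and cos(u - c/2) decreases with the distance
    of u to the centre on the circle. *)
Lemma arc_cosE (c u : R) : 0 <= c <= 2 * pi -> 0 < u < 2 * pi ->
  (cos (c / 2) < cos (u - c / 2)) = (u < c).
Proof.
move=> /andP[c0 c2] /andP[u0 u2].
have mono := @ltr_cos R; have c2pi : c / 2 \in `[0, pi].
  by rewrite in_itv/=; apply/andP; split; lra.
have [uc|cu] := ltP u c.
  rewrite -[cos (u - _)]cos_norm mono//.
    by rewrite ltr_norml; apply/andP; split; lra.
  by rewrite in_itv/= normr_ge0 ler_norml; apply/andP; split; lra.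
apply/negbTE; rewrite -leNgt.
have [u1|u1] := leP (u - c / 2) pi.
  rewrite leNgt mono// -?leNgt; first lra.
  by rewrite in_itv/=; apply/andP; split; lra.
have -> : cos (u - c / 2) = cos (2 * pi - (u - c / 2)).
  have := cosD2pi (- (u - c / 2)); rewrite cosN => <-.
  by congr cos; rewrite -mulr_natl; ring.
rewrite leNgt mono// -?leNgt; first lra.
by rewrite in_itv/=; apply/andP; split; lra.
Qed.
End step_approximation.

(** * Negligibility of the boundary of the period cell *)

Section torus_cell.
Context {R : realType}.
Local Notation RM := (measurableTypeR R).

Lemma circle_prob_oo : circle_prob `]0, 2 * pi[%classic = 1%E :> \bar R.
Proof.
transitivity (\int[@lebesgue_measure R]_(x in `]0%R, (2 * pi)%R[)
  (uniform_pdf 0 (2 * pi) x)%:E)%E; first by [].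
rewrite integral_itv_obnd_cbnd; last first.
  apply/measurable_EFinP; apply: measurable_funTS; exact: measurable_uniform_pdf.
rewrite integral_itv_bndo_bndc; last first.
  apply/measurable_EFinP; apply: measurable_funTS; exact: measurable_uniform_pdf.
by rewrite integral_uniform_pdf1//; first exact: two_pi_gt0.
Qed.

Definition open_cell n : set (n.-tuple RM) :=
  [set t | forall i, 0 < tnth t i < 2 * pi].

Lemma measurable_open_cell n : measurable (@open_cell n).
Proof.
rewrite (_ : @open_cell n = \bigcap_(i in [set: 'I_n])
    (fun t => tnth t i) @^-1` `]0, 2 * pi[%classic).
  apply: fin_bigcap_measurable => // i _; rewrite -[X in measurable X]setTI.
  exact: measurable_tnth.
apply/seteqP; split => t /= ht i; first by rewrite /= in_itv/= => _; exact: ht.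
by have := ht i Logic.I; rewrite /= in_itv.
Qed.

Lemma torus_prob_open_cell n : torus_prob n (@open_cell n) = 1%E :> \bar R.
Proof.
elim: n => [|n IHn].
  rewrite (_ : @open_cell 0 = setT) ?probability_setT//.
  by apply/seteqP; split => // t _ [].
rewrite /= /distribution /pushforward/=.
rewrite (_ : _ @^-1` _ = `]0, 2 * pi[%classic `*` @open_cell n).
  transitivity (circle_prob `]0%R, (2 * pi : R)%R[%classic *
    torus_prob n (@open_cell n))%E; last by rewrite circle_prob_oo mul1e.
  by rewrite product_measure1E//; exact: measurable_open_cell.
apply/seteqP; split => [[x t]/= h|[x t] [/= x0 tn] i].
  split; first by have := h ord0; rewrite tnth0 in_itv.
  by move=> i; have := h (lift ord0 i); rewrite tnthS.
case: (unliftP ord0 i) => [j|] ->; first by rewrite tnthS; exact: tn.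
by rewrite tnth0; move: x0; rewrite in_itv.
Qed.

Lemma torus_cell_ae n :
  {ae @torus_prob R n, forall t, forall i, 0 < tnth t i < 2 * pi}.
Proof.
have mC := measurableC (@measurable_open_cell n).
have h := probability_setC (torus_prob n) (@measurable_open_cell n).
rewrite torus_prob_open_cell subee// in h.
have := (negligibleP (torus_prob n) mC).2 h.
exact.
Qed.
End torus_cell.

(** * Uniqueness of Fourier coefficients of integrable functions *)

Section uniqueness.
Context {R : realType} {n : nat}.
Local Notation RM := (measurableTypeR R).
Local Notation TT := (n.-tuple RM).
Local Notation P := (@torus_prob R n).
Implicit Types (h f g : TT -> R) (k m : 'rV[int]_n).

(** Stated for all frequencies at once so that the property is stable under
    multiplication by trigonometric polynomials, see [null_spectrum_trig]. *)
Definition null_spectrum h := P.-integrable setT (EFin \o h) /\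
  forall k, \int[P]_t (h t * tcos k t) = 0 /\ \int[P]_t (h t * tsin k t) = 0.

Inductive trig_poly : (TT -> R) -> Prop :=
| trig_poly_cst c : trig_poly (fun=> c)
| trig_poly_cos k : trig_poly (tcos k)
| trig_poly_sin k : trig_poly (tsin k)
| trig_polyD f g : trig_poly f -> trig_poly g -> trig_poly (fun t => f t + g t)
| trig_polyM f g : trig_poly f -> trig_poly g -> trig_poly (fun t => f t * g t).

Lemma integrable_mul_bounded h g (M : R) : P.-integrable setT (EFin \o h) ->
  measurable_fun setT g -> (forall t, `|g t| <= M) ->
  P.-integrable setT (EFin \o (fun t => h t * g t)).
Proof.
move=> ih mg gM; rewrite (_ : _ \o _ = ((EFin \o h) \* (EFin \o g))%E)//.
apply: integrableMl => //; exists M; split => [|y My t _]; first exact: num_real.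
exact: le_trans (gM t) (ltW My).
Qed.

Lemma integrable_mul_tcos h k : P.-integrable setT (EFin \o h) ->
  P.-integrable setT (EFin \o (fun t => h t * tcos k t)).
Proof.
move=> ih; apply: (integrable_mul_bounded (M := 1)) => //.
  exact: measurable_tcos.
by move=> t; exact: cos_max.
Qed.

Lemma integrable_mul_tsin h k : P.-integrable setT (EFin \o h) ->
  P.-integrable setT (EFin \o (fun t => h t * tsin k t)).
Proof.
move=> ih; apply: (integrable_mul_bounded (M := 1)) => //.
  exact: measurable_tsin.
by move=> t; exact: sin_max.
Qed.

Lemma null_spectrum_lin h h' (c d : R) : null_spectrum h -> null_spectrum h' ->
  null_spectrum (fun t => c * h t + d * h' t).
Proof.
move=> [ih h0] [ih' h0']; split; first exact: integrable_lin.
move=> k; split.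
- under eq_Rintegral do rewrite mulrDl -!mulrA.
  rewrite Rintegral_lin ?(h0 k).1 ?(h0' k).1 ?mulr0 ?addr0//;
    exact: integrable_mul_tcos.
- under eq_Rintegral do rewrite mulrDl -!mulrA.
  rewrite Rintegral_lin ?(h0 k).2 ?(h0' k).2 ?mulr0 ?addr0//;
    exact: integrable_mul_tsin.
Qed.

(** Multiplication by cos<m,x> or sin<m,x> only mixes the coefficients of
    frequencies k - m and k + m. *)
Lemma null_spectrum_trig h f : trig_poly f -> null_spectrum h ->
  null_spectrum (fun t => h t * f t).
Proof.
move=> tf; elim: tf h => {f} [c|m|m|f g _ IHf _ IHg|f g _ IHf _ IHg] h hh.
- have := null_spectrum_lin c 0 hh hh.
  by under eq_fun do rewrite mul0r addr0 mulrC.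
- have [ih h0] := hh; split; first exact: integrable_mul_tcos.
  move=> k; split.
  + rewrite (_ : (fun t => _) =
      (fun t => 2^-1 * (h t * tcos (m - k) t) + 2^-1 * (h t * tcos (m + k) t))).
      rewrite Rintegral_lin; [|exact: integrable_mul_tcos..].
      by rewrite !(h0 _).1 !mulr0 addr0.
    by apply/funext => t; rewrite -mulrA tcosM; ring.
  + rewrite (_ : (fun t => _) =
      (fun t => 2^-1 * (h t * tsin (k + m) t) + 2^-1 * (h t * tsin (k - m) t))).
      rewrite Rintegral_lin; [|exact: integrable_mul_tsin..].
      by rewrite !(h0 _).2 !mulr0 addr0.
    by apply/funext => t; rewrite -mulrA [tcos m t * _]mulrC tsincosM; ring.
- have [ih h0] := hh; split; first exact: integrable_mul_tsin.
  move=> k; split.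
  + rewrite (_ : (fun t => _) =
      (fun t => 2^-1 * (h t * tsin (m + k) t) + 2^-1 * (h t * tsin (m - k) t))).
      rewrite Rintegral_lin; [|exact: integrable_mul_tsin..].
      by rewrite !(h0 _).2 !mulr0 addr0.
    by apply/funext => t; rewrite -mulrA tsincosM; ring.
  + rewrite (_ : (fun t => _) =
      (fun t => 2^-1 * (h t * tcos (m - k) t) + (- 2^-1) * (h t * tcos (m + k) t))).
      rewrite Rintegral_lin; [|exact: integrable_mul_tcos..].
      by rewrite !(h0 _).1 !mulr0 addr0.
    by apply/funext => t; rewrite -mulrA tsinM; ring.
- have := null_spectrum_lin 1 1 (IHf h hh) (IHg h hh).
  by under eq_fun do rewrite !mul1r -mulrDr.
- have := IHg _ (IHf h hh).
  by under eq_fun do rewrite -mulrA.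
Qed.

Lemma null_spectrum_mean h : null_spectrum h -> \int[P]_t h t = 0.
Proof.
move=> [_ /(_ 0)[+ _]]; under eq_Rintegral => t _.
  rewrite /tcos (_ : freq_dot 0 _ = 0); last first.
    by rewrite /freq_dot big1// => j _; rewrite mxE mul0r.
  rewrite cos0 mulr1; over.
by [].
Qed.

Lemma trig_poly_measurable f : trig_poly f -> measurable_fun setT f.
Proof.
elim=> {f} [c|k|k|f g _ mf _ mg|f g _ mf _ mg].
- exact: measurable_cst.
- exact: measurable_tcos.
- exact: measurable_tsin.
- exact: measurable_funD.
- exact: measurable_funM.
Qed.

Lemma trig_polyX f N : trig_poly f -> trig_poly (fun t => f t ^+ N).
Proof.
move=> tf; elim: N => [|N IHN]; first by under eq_fun do rewrite expr0; exact: trig_poly_cst.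
by under eq_fun do rewrite exprS; exact: trig_polyM.
Qed.

Lemma trig_poly_prod (I : Type) (s : seq I) (f : I -> TT -> R) :
  (forall i, trig_poly (f i)) -> trig_poly (fun t => \prod_(i <- s) f i t).
Proof.
move=> tf; elim: s => [|i s IHs].
  by under eq_fun do rewrite big_nil; exact: trig_poly_cst.
by under eq_fun do rewrite big_cons; exact: trig_polyM.
Qed.

Lemma trig_poly_step f N : trig_poly f -> trig_poly (fun t => step_poly N (f t)).
Proof.
move=> tf; apply: trig_polyX; apply: trig_polyD; first exact: trig_poly_cst.
under eq_fun do rewrite -mulN1r; apply: trig_polyM; first exact: trig_poly_cst.
exact: trig_polyX.
Qed.

(** An affine image of cos(t_i - c/2), with values in [0, 1], that is less than 1/2
    exactly on the arc ]0, c[ of the i-th circle. *)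
Definition arc_fun (c : R) (i : 'I_n) (t : TT) : R :=
  2^-1 + 4^-1 * (cos (c / 2) - cos (tnth t i - c / 2)).

Lemma arc_fun_trig c i : trig_poly (arc_fun c i).
Proof.
rewrite (_ : arc_fun c i = fun t => (2^-1 + 4^-1 * cos (c / 2)) +
    ((- (4^-1 * cos (c / 2))) * tcos (delta_mx 0 i) t +
     (- (4^-1 * sin (c / 2))) * tsin (delta_mx 0 i) t)).
  apply: trig_polyD; first exact: trig_poly_cst.
  by apply: trig_polyD; apply: trig_polyM;
    [exact: trig_poly_cst|exact: trig_poly_cos|exact: trig_poly_cst|exact: trig_poly_sin].
apply/funext => t; rewrite /arc_fun /tcos /tsin.
rewrite (_ : freq_dot _ _ = tnth t i); first by rewrite cosB; ring.
rewrite /freq_dot (bigD1 i)//= !mxE !eqxx mul1r big1 ?addr0// => j ji.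
by rewrite mxE (negbTE ji) andbF mul0r.
Qed.

Lemma arc_fun_bounds c i t : 0 <= arc_fun c i t <= 1.
Proof.
rewrite /arc_fun.
have := cos_le1 (c / 2); have := cos_geN1 (c / 2).
have := cos_le1 (tnth t i - c / 2); have := cos_geN1 (tnth t i - c / 2).
by lra.
Qed.

(** Restriction of an arbitrary bound to [0, 2 pi]; it does not change the trace
    of a ray on the open period cell. *)
Definition clip (c : R) : R := Num.max 0 (Num.min c (2 * pi)).

Lemma clip_bounds c : 0 <= clip c <= 2 * pi.
Proof.
rewrite /clip le_max lexx/= ge_max ge_min lexx orbT andbT.
by rewrite mulr_ge0// pi_ge0.
Qed.

Lemma clip_lt c u : 0 < u < 2 * pi -> (u < clip c) = (u < c).
Proof.
move=> /andP[u0 u2]; rewrite /clip lt_max lt_min u2 andbT.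
by rewrite ltNge (ltW u0).
Qed.

Lemma arc_fun_lt c i t : 0 < tnth t i < 2 * pi ->
  (arc_fun (clip c) i t < 2^-1) = (tnth t i < c).
Proof.
move=> ti; rewrite -[RHS]clip_lt// -[RHS]arc_cosE ?clip_bounds// /arc_fun.
by apply/idP/idP => ?; lra.
Qed.

Definition lower_box (c : 'I_n -> R) : set TT := [set t | forall i, tnth t i < c i].

Lemma measurable_lower_box c : measurable (lower_box c).
Proof.
rewrite (_ : lower_box c = \bigcap_(i in [set: 'I_n])
    (fun t => tnth t i) @^-1` `]-oo, c i[%classic).
  apply: fin_bigcap_measurable => // i _; rewrite -[X in measurable X]setTI.
  exact: measurable_tnth.
apply/seteqP; split => t /= ht i; first by rewrite /= in_itv/= => _; exact: ht.
by have := ht i Logic.I; rewrite /= in_itv.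
Qed.

Lemma torus_ae_filter : Filter (almost_everywhere P).
Proof. exact: (ae_filter_ringOfSetsType P). Qed.

(** On the open period cell the indicator of the box is the bounded limit of the
    trigonometric polynomials [psi N], against which [h] has integral 0. *)
Lemma null_spectrum_lower_box h c : null_spectrum h ->
  \int[P]_(t in lower_box c) h t = 0.
Proof.
move=> hh; have [ih _] := hh.
pose psi N (t : TT) := \prod_(i < n) step_poly N (arc_fun (clip (c i)) i t).
pose ind (t : TT) : R := \prod_(i < n) (arc_fun (clip (c i)) i t < 2^-1)%R%:R.
have tpsi N : trig_poly (psi N).
  by apply: trig_poly_prod => i; apply: trig_poly_step; exact: arc_fun_trig.
have cpsi t : psi N t @[N --> \oo] --> ind t.
  apply: cvg_big => [|i _]; first exact: mul_continuous.
  by apply: step_poly_cvg; exact: arc_fun_bounds.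
have psi1 N t : `|psi N t| <= 1.
  rewrite /psi normr_prod; apply: prodr_ile1 => i _.
  have /andP[h0 h1] := step_poly_bounds N (arc_fun_bounds (clip (c i)) i t).
  by rewrite normr_ge0 ger0_norm.
have mind : measurable_fun setT ind.
  apply: (measurable_fun_cvg (fun N => trig_poly_measurable (tpsi N))) => t _.
  exact: cpsi.
have c0 : \int[P]_t (h t * psi N t) @[N --> \oo] --> \int[P]_t (h t * ind t).
  apply: (@Rintegral_dominated_cvg _ _ _ _ _ _ (fun t => `|h t|)).
  - move=> N; apply: measurable_funM; last exact: trig_poly_measurable (tpsi N).
    by apply/measurable_EFinP; case/integrableP : ih.
  - by move=> t; apply: cvgM; [exact: cvg_cst|exact: cpsi].
  - exact: integrable_norm.
  - by move=> N t; rewrite normrM ler_piMr.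
rewrite Rintegral_mkcond.
transitivity (\int[P]_t (h t * ind t)); last first.
  rewrite -(cvg_lim _ c0)//; apply: cvg_lim => //.
  under eq_fun do rewrite (null_spectrum_mean (null_spectrum_trig (tpsi _) hh)).
  exact: cvg_cst.
rewrite /Rintegral; congr fine; apply: ae_eq_integral => //.
- apply/measurable_EFinP.
  apply: (measurable_restrictT h (measurable_lower_box c)).1.
  by apply: measurable_funTS; apply/measurable_EFinP; case/integrableP : ih.
- apply/measurable_EFinP; apply: measurable_funM => //.
  by apply/measurable_EFinP; case/integrableP : ih.
apply: (@filterS _ _ torus_ae_filter _ _ _ (torus_cell_ae n)) => t ti _; congr EFin.
have -> : ind t = (t \in lower_box c)%:R.
  rewrite /ind; under eq_bigr do rewrite arc_fun_lt//.
  case: (boolP (t \in lower_box c)) => [|/negP tB].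
    by rewrite inE => tB; rewrite big1// => i _; rewrite tB.
  have [i ti0] : exists i, ~~ (tnth t i < c i).
    apply: contrapT => /forallNP tN; apply: tB; rewrite inE => i.
    by have /negP := tN i; rewrite negbK.
  by rewrite (bigD1 i)//= (negbTE ti0) mul0r.
by rewrite patchE; case: ifP => _; rewrite ?mulr1 ?mulr0.
Qed.

Definition lower_boxes : set (set TT) := [set lower_box c | c in [set: 'I_n -> R]].

Lemma measurable_lower_boxesE : @measurable _ TT = <<s lower_boxes >>.
Proof.
apply/seteqP; split => A mA; last first.
  apply: (smallest_sub _ _ mA); first exact: sigma_algebra_measurable.
  by move=> _ [c _ <-]; exact: measurable_lower_box.
pose G := g_sigma_algebraType lower_boxes.
have mid : measurable_fun setT (fun t : G => (t : TT)).
  apply/measurable_fun_tnthP => i.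
  apply: (measurability _ (RGenInftyO.measurableE R)) => _ [_ [x ->] <-].
  rewrite setTI (_ : _ @^-1` _ = \bigcup_(N : nat)
      lower_box (fun j => if j == i then x else N%:R)).
    apply: (@bigcup_measurable _ G) => N _; apply: sub_sigma_algebra.
    by eexists.
  apply/seteqP; split => [t /=|t [N _] /(_ i)]; last first.
    by rewrite eqxx /= in_itv.
  rewrite in_itv/= => ti.
  (* an integer above all coordinates of t *)
  exists (Num.truncn (\sum_(j < n) `|tnth t j|)).+1 => // j.
  case: eqP => [->//|_]; apply: le_lt_trans (truncnS_gt _).
  by rewrite (le_trans (ler_norm _))// (bigD1 j)//= lerDl sumr_ge0.
by have := mid measurableT A mA; rewrite setTI.
Qed.

(** The boxes form a pi-system generating the measurable sets, and the sets over
    which [h] has integral 0 form a lambda-system. *)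
Lemma null_spectrum_ae0 h : null_spectrum h -> {ae P, forall t, h t = 0}.
Proof.
move=> hh; have [ih _] := hh.
have EFin_int A : measurable A ->
    (\int[P]_(t in A) (h t)%:E = (\int[P]_(t in A) h t)%R%:E)%E.
  by move=> mA; rewrite fineK//; apply: integrable_fin_num => //; exact: integrableS ih.
have int0 A : measurable A -> \int[P]_(t in A) h t = 0.
  move=> mA; move: (mA); rewrite measurable_lower_boxesE.
  move: A {mA}; apply: (@dynkin_induction _ TT lower_boxes
      (fun A => \int[P]_(t in A) h t = 0)).
  - exact: measurable_lower_boxesE.
  - move=> _ _ [c _ <-] [d _ <-]; exists (fun i => Num.min (c i) (d i)) => //.
    apply/seteqP; split => [t tcd|t [tc td] i].
      by split => i; have := tcd i; rewrite lt_min => /andP[].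
    by rewrite lt_min tc td.
  - exact: null_spectrum_mean.
  - by move=> _ [c _ <-]; exact: null_spectrum_lower_box.
  - move=> S mS S0; have := @Rintegral_setU _ _ _ P S (~` S) h mS (measurableC mS).
    rewrite setUv S0 add0r (null_spectrum_mean hh) => <-//.
    by apply/disj_setPS; rewrite setICr.
  - move=> F mF tF F0; rewrite /Rintegral integral_bigcup//; last first.
      by apply: integrableS ih => //; exact: bigcup_measurable.
    by rewrite eseries0// => i _ _; rewrite EFin_int// F0.
have : ae_eq P setT (EFin \o h) (cst 0%E).
  by apply: integral_ae_eq => // A _ mA; rewrite integral0 EFin_int// int0.
by apply: (@filterS _ _ torus_ae_filter) => t /(_ Logic.I) [].
Qed.
End uniqueness.

(** * Frequency shells *)

Section shells.
Context {R : realType} {n : nat}.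
Variable b : nat.
Hypothesis b_ge2 : (2 <= b)%N.
Implicit Types k : 'rV[int]_n.

(** The block of index nu is shifted to index nu + 1 to make room for a shell
    containing the zero frequency, which belongs to no block. *)
Definition freq_shell (nu : nat) : seq 'rV[int]_n :=
  if nu is m.+1 then finmap.enum_fset (fset_set (@freq_block R n b m)) else [:: 0].

Lemma mem_freq_shellS nu k : (k \in freq_shell nu.+1) =
  (b ^ nu < b * freq_norm k)%N && (freq_norm k <= b ^ nu)%N.
Proof.
have b0 : (0 : R) < b%:R by rewrite ltr0n; lia.
have -> : (k \in freq_shell nu.+1) = (k \in @freq_block R n b nu).
  by have := in_fset_set (@finite_freq_block R n b nu) k.
rewrite mem_setE /freq_block/=; congr andb; last by rewrite -natrX ler_nat.
rewrite expfzDr ?gt_eqF// -exprnP exprN1 ltr_pdivrMr//.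
by rewrite -natrX -natrM ltr_nat mulnC.
Qed.

Lemma freq_norm_eq0 k : (freq_norm k == 0%N) = (k == 0).
Proof.
apply/eqP/eqP => [k0|->]; last by rewrite /freq_norm big1// => j _; rewrite mxE.
apply/rowP => j; rewrite mxE; apply/eqP; rewrite -absz_eq0.
by move/eqP: k0; rewrite /freq_norm sum_nat_eq0 => /forallP/(_ j).
Qed.

Lemma freq_normN k : freq_norm (- k) = freq_norm k.
Proof. by apply: eq_bigr => j _; rewrite mxE abszN. Qed.

Lemma freq_shell_uniq nu : uniq (freq_shell nu).
Proof. by case: nu => [//|nu]; exact: finmap.fset_uniq. Qed.

Lemma freq_shell_opp nu k : (- k \in freq_shell nu) = (k \in freq_shell nu).
Proof.
by case: nu => [|nu]; [rewrite !inE oppr_eq0|rewrite !mem_freq_shellS freq_normN].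
Qed.

(** A nonzero k lies in the block of the least nu such that |k| <= b^nu, and in no
    other one. *)
Lemma freq_shell_cover k : exists nu0, forall nu, (k \in freq_shell nu) = (nu == nu0).
Proof.
have [k0|k0] := eqVneq k 0.
  exists 0%N => -[|nu]; first by rewrite k0 inE eqxx.
  have /eqP K0 : freq_norm k == 0%N by rewrite freq_norm_eq0 k0.
  by rewrite mem_freq_shellS K0 muln0 ltn0.
have K0 : (0 < freq_norm k)%N by rewrite lt0n freq_norm_eq0.
have b1 : (1 < b)%N by [].
exists (up_log b (freq_norm k)).+1 => -[|nu]; first by rewrite inE (negbTE k0).
rewrite mem_freq_shellS eqSS; set K := freq_norm k; set u := up_log b K.
apply/andP/eqP => [[bK Kb]|->].
  apply/eqP; rewrite eqn_leq (up_log_min b1 Kb) andbT -ltnS.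
  rewrite -(ltn_exp2l _ _ b1) (leq_trans bK)// expnS leq_mul2l.
  by rewrite (up_logP _ b1) orbT.
split; last exact: up_logP.
have [K1|K1] := ltnP 1 K; last first.
  have KE : K = 1%N by apply/eqP; rewrite eqn_leq K1.
  by rewrite /u KE up_log1 muln1.
have := up_log_gtn b1 K1; rewrite -(ltn_pmul2l (ltnW b1)) -expnS prednK//.
by rewrite up_log_gt0 b1.
Qed.

Lemma size_freq_shellS nu : (size (freq_shell nu.+1) <= (3 * b ^ nu) ^ n)%N.
Proof.
set N := (b ^ nu)%N.
have N0 : (0 < N)%N by rewrite expn_gt0; lia.
pose F (g : {ffun 'I_n -> 'I_(N + N).+1}) : 'rV[int]_n :=
  \row_j ((g j)%:Z - N%:Z).
have sub : {subset freq_shell nu.+1 <= map F (enum {: {ffun 'I_n -> 'I_(N + N).+1}})}.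
  move=> k; rewrite mem_freq_shellS => /andP[_ kN].
  have kjN j : (absz (k ord0 j) <= N)%N.
    by apply: leq_trans kN; rewrite /freq_norm (bigD1 j)//= leq_addr.
  apply/mapP; exists [ffun j => inord (absz (k ord0 j + N%:Z))].
    by rewrite mem_enum.
  apply/rowP => j; rewrite mxE ffunE.
  have := kjN j; set z := k ord0 j => zN.
  rewrite inordK; lia.
have := uniq_leq_size (freq_shell_uniq _) sub.
rewrite size_map -cardE card_ffun !card_ord => /leq_trans; apply.
by case: (posnP n) => [->|n0]; rewrite ?expn0// leq_exp2r//; lia.
Qed.
End shells.

Lemma sqr_sum_le (R : realFieldType) (I : Type) (s : seq I) (x : I -> R) :
  (\sum_(i <- s) x i) ^+ 2 <= (size s)%:R * \sum_(i <- s) x i ^+ 2.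
Proof.
elim: s => [|i s IHs]; first by rewrite !big_nil expr0n mul0r.
rewrite !big_cons /=; move: IHs; set S := \sum_(i <- s) _; set Q := \sum_(i <- s) _.
case: s => [|j s'] in S Q * => /=.
  by rewrite /S /Q !big_nil !addr0 mul1r.
set m := (size s').+1; rewrite -natr1; have m0 : (0 : R) < m%:R by rewrite ltr0n.
move: (m%:R : R) m0 => c c0 SQ.
have h := sqr_ge0 (c * x i - S).
(* h, divided by the length c of the tail, bounds the cross term *)
have : c * (2 * x i * S) <= c * (c * x i ^+ 2 + Q) by rewrite !expr2 in h SQ *; nra.
by rewrite ler_pM2l// => h2; rewrite !expr2 in SQ h2 *; nra.
Qed.

(** * Fourier series of a function of the class *)

Section regularity.
Context {R : realType} {n b : nat}.
Hypothesis b_ge2 : (2 <= b)%N.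
Local Notation RM := (measurableTypeR R).
Local Notation TT := (n.-tuple RM).
Local Notation P := (@torus_prob R n).

(** The exponent 2l + n is at most 2 tau + 2, and b |k| >= b^nu on the block,
    so |k|^(2l) <= |k|^(2 tau + 2) (b / b^nu)^n; the last factor compensates for
    the cardinality of the block, at most (3 b^nu)^n, which the Cauchy-Schwarz
    inequality introduces. *)
Lemma shell_weight_le_block (tau : R) l (al be N : 'rV[int]_n -> R) nu :
  (2 * l + n)%:R <= 2 * tau + 2 ->
  (forall k, `|al k| <= N k) -> (forall k, `|be k| <= N k) ->
  shell_weight l (@freq_shell R n b) al be nu.+1 <=
  2 ^+ l.+1 * Num.sqrt ((3 * b%:R) ^+ n) *
  Num.sqrt (\sum_(k <- @freq_shell R n b nu.+1)
    N k ^+ 2 * (freq_norm k)%:R `^ (2 * tau + 2)).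
Proof.
move=> ltau alN beN; set s := freq_shell b nu.+1; set S := \sum_(k <- s) _.
have N0 k : 0 <= N k by exact: le_trans (alN k).
have b0 : (0 : R) < b%:R by rewrite ltr0n; lia.
pose x k : R := N k * (freq_norm k)%:R ^+ l.
have x0 k : 0 <= x k by rewrite mulr_ge0.
have sK k : k \in s -> (0 < freq_norm k)%N /\ (b ^ nu <= b * freq_norm k)%N.
  rewrite mem_freq_shellS// => /andP[h _]; split; last exact: ltnW.
  by case: (freq_norm k) h => //; rewrite muln0.
have wx : shell_weight l (@freq_shell R n b) al be nu.+1 <=
    2 ^+ l.+1 * \sum_(k <- s) x k.
  rewrite mulr_sumr /shell_weight big_seq [leRHS]big_seq; apply: ler_sum => k ks.
  have [K0 _] := sK k ks.
  rewrite exprS /x mulrACA; apply: ler_pM; rewrite ?addr_ge0 ?exprn_ge0//.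
    by rewrite mulr_natl mulr2n lerD.
  rewrite -exprMn lerXn2r ?nnegrE ?mulr_ge0// -natrM ler_nat; lia.
rewrite (le_trans wx)// -mulrA ler_wpM2l ?exprn_ge0//.
have -> : \sum_(k <- s) x k = Num.sqrt ((\sum_(k <- s) x k) ^+ 2).
  by rewrite sqrtr_sqr ger0_norm// sumr_ge0.
rewrite -sqrtrM; last by rewrite exprn_ge0// mulr_ge0// ltW.
apply: ler_wsqrtr; rewrite (le_trans (sqr_sum_le _ _))//.
have xD k : k \in s -> x k ^+ 2 <=
    N k ^+ 2 * (freq_norm k)%:R `^ (2 * tau + 2) * (b%:R / b%:R ^+ nu) ^+ n.
  move=> /sK[K0 Kb]; rewrite /x exprMn -mulrA ler_wpM2l ?sqr_ge0//.
  have K1 : 1 <= (freq_norm k)%:R :> R by rewrite ler1n.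
  have h1 : (freq_norm k)%:R ^+ (2 * l + n) <= (freq_norm k)%:R `^ (2 * tau + 2) :> R.
    by rewrite -powR_mulrn//; exact: ler_powR.
  apply: le_trans (ler_wpM2r _ h1); last by rewrite exprn_ge0// divr_ge0// ?exprn_ge0// ltW.
  rewrite exprD -mulrA -exprM mulnC -exprMn ler_peMr ?exprn_ge0// exprn_ege1//.
  by rewrite mulrA ler_pdivlMr ?exprn_gt0// mul1r mulrC -natrX -natrM ler_nat.
apply: (@le_trans _ _ ((3 * b%:R ^+ nu) ^+ n * (S * (b%:R / b%:R ^+ nu) ^+ n))).
  apply: ler_pM => //.
  - by apply: sumr_ge0 => k _; exact: sqr_ge0.
  - by rewrite -!natrX -natrM -natrX ler_nat; exact: size_freq_shellS.
  - by rewrite mulr_suml big_seq [leRHS]big_seq; exact: ler_sum.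
rewrite mulrCA -exprMn mulrC ler_wpM2r//.
  by apply: sumr_ge0 => k _; rewrite mulr_ge0 ?sqr_ge0// powR_ge0.
rewrite le_eqVlt; apply/orP; left; apply/eqP; congr (_ ^+ n).
by field; rewrite gt_eqF// exprn_gt0.
Qed.

Variables (tau : R) (f : 'rV[R]_n -> 'rV[R]_n).
Hypothesis f_int : torus_integrable f.

Let fj (j : 'I_n) (t : TT) : R := f (row_of_tuple t) 0 j.
Definition cos_coef (j : 'I_n) k : R := \int[P]_t (f (row_of_tuple t) 0 j * tcos k t).
Definition sin_coef (j : 'I_n) k : R := \int[P]_t (f (row_of_tuple t) 0 j * tsin k t).

Lemma fourier_coefE k j :
  fourier_coef f k 0 j = (cos_coef j k +i* - sin_coef j k)%C.
Proof.
rewrite mxE /torus_Cintegral; congr (_ +i* _)%C.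
  by apply: eq_Rintegral => t _; rewrite /= mul0r subr0 cosN.
transitivity (\int[P]_t (-1 * (f (row_of_tuple t) 0 j * tsin k t))).
  by apply: eq_Rintegral => t _; rewrite /= mul0r addr0 sinN mulrN mulN1r.
by rewrite RintegralZl ?mulN1r//; apply: integrable_mul_tsin; exact: f_int.
Qed.

Lemma Cvec_norm_ge j k : `|cos_coef j k| <= Cvec_norm (fourier_coef f k) /\
  `|sin_coef j k| <= Cvec_norm (fourier_coef f k).
Proof.
have h : cos_coef j k ^+ 2 + sin_coef j k ^+ 2 <=
    \sum_i Normc.normc (fourier_coef f k 0 i) ^+ 2.
  rewrite (bigD1 j)//= fourier_coefE /= sqrrN sqr_sqrtr ?addr_ge0 ?sqr_ge0//.
  by rewrite lerDl sumr_ge0// => i _; exact: sqr_ge0.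
by split; rewrite -sqrtr_sqr; apply: ler_wsqrtr; apply: le_trans h;
  rewrite ?lerDl ?lerDr sqr_ge0.
Qed.

Lemma block_normE nu : block_norm tau b nu f =
  Num.sqrt (\sum_(k <- @freq_shell R n b nu.+1)
    Cvec_norm (fourier_coef f k) ^+ 2 * (freq_norm k)%:R `^ (2 * tau + 2)).
Proof. by rewrite /block_norm fsbig_finite//; exact: finite_freq_block. Qed.

Lemma coef_summable l j : (2 * l + n)%:R <= 2 * tau + 2 ->
  (\sum_(0 <= nu <oo) (block_norm tau b nu f)%:E < +oo)%E ->
  cvgn (series (shell_weight l (@freq_shell R n b) (cos_coef j) (sin_coef j))).
Proof.
move=> ltau fsum.
pose w := shell_weight l (@freq_shell R n b) (cos_coef j) (sin_coef j).
have cB : cvgn (series (fun nu => block_norm tau b nu f)).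
  by apply: nnseries_is_cvg => // nu; exact: sqrtr_ge0.
have cw : cvgn (series (fun nu => w nu.+1)).
  pose C := 2 ^+ l.+1 * Num.sqrt ((3 * b%:R) ^+ n) : R.
  apply: (@series_le_cvg _ _ (fun nu => C * block_norm tau b nu f)) => [nu|nu|nu|].
  - exact: shell_weight_ge0.
  - by rewrite mulr_ge0 ?mulr_ge0 ?exprn_ge0 ?sqrtr_ge0.
  - rewrite block_normE; apply: shell_weight_le_block => // k.
      exact: (Cvec_norm_ge j k).1.
    exact: (Cvec_norm_ge j k).2.
  - rewrite (_ : series _ = fun N => C * series (fun nu => block_norm tau b nu f) N).
      by apply/cvg_ex; eexists; apply: cvgM; [exact: cvg_cst|exact: cB].
    by apply/funext => N; rewrite /series/= mulr_sumr.
apply/cvg_ex; exists (w 0%N + limn (series (fun nu => w nu.+1))).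
rewrite -cvg_shiftS.
rewrite (_ : (fun N => _) = (fun N => w 0%N + series (fun nu => w nu.+1) N)).
  by apply: cvgD; [exact: cvg_cst|exact: cw].
by apply/funext => N; rewrite /series/= big_nat_recl.
Qed.

Lemma cos_coefN j k : cos_coef j (- k) = cos_coef j k.
Proof.
by apply: eq_Rintegral => t _; rewrite /tcos freq_dotNl cosN.
Qed.

Lemma sin_coefN j k : sin_coef j (- k) = - sin_coef j k.
Proof.
rewrite -mulN1r -RintegralZl//; last by apply: integrable_mul_tsin; exact: f_int.
by apply: eq_Rintegral => t _; rewrite /tsin freq_dotNl sinN mulrN mulN1r.
Qed.

Definition fourier_series : 'rV[R]_n -> 'rV[R]_n :=
  fun x => \row_j trig_series (@freq_shell R n b) (cos_coef j) (sin_coef j) x.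

(** Each component of the difference is integrable with null spectrum. *)
Lemma fourier_series_ae :
  (forall j, cvgn (series (shell_weight 0 (@freq_shell R n b) (cos_coef j) (sin_coef j)))) ->
  torus_ae_eq f fourier_series.
Proof.
move=> cw.
have hj j : {ae P, forall t, f (row_of_tuple t) 0 j -
    trig_series (@freq_shell R n b) (cos_coef j) (sin_coef j) (row_of_tuple t) = 0}.
  apply: null_spectrum_ae0; have iG := bounded_integrable P
    (trig_series_measurable (cw j)) (fun t => trig_series_bounded (cw j) _).
  split => [|k].
    rewrite (_ : _ \o _ = ((EFin \o fj j) \- (EFin \o (fun t : TT => trig_series
      (@freq_shell R n b) (cos_coef j) (sin_coef j) (row_of_tuple t))))%E)//.
    by apply: integrableB => //; exact: f_int.
  split.
  - under eq_Rintegral do rewrite mulrBl.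
    rewrite RintegralB//; last 2 first.
    + by apply: integrable_mul_tcos; exact: f_int.
    + exact: integrable_mul_tcos.
    rewrite trig_series_cos_coef ?subrr//.
    + exact: freq_shell_uniq.
    + exact: freq_shell_opp.
    + exact: freq_shell_cover.
    + exact: cos_coefN.
  - under eq_Rintegral do rewrite mulrBl.
    rewrite RintegralB//; last 2 first.
    + by apply: integrable_mul_tsin; exact: f_int.
    + exact: integrable_mul_tsin.
    rewrite trig_series_sin_coef ?subrr//.
    + exact: freq_shell_uniq.
    + exact: freq_shell_opp.
    + exact: freq_shell_cover.
    + exact: sin_coefN.
have FP := @torus_ae_filter R n.
have : {ae P, forall t, forall j, f (row_of_tuple t) 0 j -
    trig_series (@freq_shell R n b) (cos_coef j) (sin_coef j) (row_of_tuple t) = 0}.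
  by apply: filter_forall => j; exact: hj.
apply: (@filterS _ _ FP) => t h; apply/rowP => j; rewrite mxE.
by apply/eqP; rewrite -subr_eq0 h.
Qed.

End regularity.

Lemma trig_series_periodic (R : realType) n (sh : nat -> seq 'rV[int]_n) a b
    (m : 'rV[int]_n) (x : 'rV[R]_n) :
  trig_series sh a b (x + (2 * pi) *: map_mx intr m) = trig_series sh a b x.
Proof.
rewrite /trig_series; congr (limn (series _)); apply/funext => nu.
apply: eq_bigr => k _; rewrite /harmonic freq_dotD freq_dotZ.
have -> : freq_dot k (map_mx intr m) = (\sum_j k 0 j * m 0 j)%:~R :> R.
  by rewrite /freq_dot rmorph_sum/=; apply: eq_bigr => j _; rewrite mxE rmorphM.
rewrite [2 * pi * _]mulrC cosD sinD cos_int2pi sin_int2pi.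
by rewrite !mulr0 !mulr1 subr0 addr0.
Qed.

Theorem theorem1p3 (R : realType) (n b : nat) (tau : R)
    (n_ge2 : (2 <= n)%N) (b_ge2 : (2 <= b)%N) (tau_ge : n%:R - 1 <= tau) :
  @Ltilde2 R n tau b `<=` @Cl_torus R n (Num.truncn (tau + 1 - n%:R / 2)).
Proof.
move=> f [f_per f_int f_sum]; set l := Num.truncn _; split=> //.
have n0 : 0 <= n%:R :> R by [].
have ltau : (2 * l + n)%:R <= 2 * tau + 2.
  have : l%:R <= tau + 1 - n%:R / 2 by rewrite truncn_le; lra.
  by rewrite natrD natrM; lra.
have cw j := coef_summable b_ge2 f_int (j := j) ltau f_sum.
exists (fourier_series (b := b) f); split.
- by move=> k x; apply/rowP => j; rewrite !mxE; exact: trig_series_periodic.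
- exact: trig_series_Cl.
- apply: fourier_series_ae => // j; exact: shell_weight_cvg_le (leq0n l) (cw j).
Qed.
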